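(* Let $\mathbb{F}$ be a finite field and let $k$ be a constant. Every infinite sequence $M_1, M_2, \ldots$ of skew-symmetric or symmetric matrices over $\mathbb{F}$ of rank-width at most $k$ has a pair $i<j$ such that $M_i$ is isomorphic to a principal submatrix of the Schur complement $(M_j/A)$ for some nonsingular principal submatrix $A$ of $M_j$.
   Context: A $V\times V$ matrix is skew-symmetric if $A=-A^t$ and all diagonal entries are zero (even in characteristic 2). Two square matrices $A_1$ ($V_1\times V_1$) and $A_2$ ($V_2\times V_2$) are isomorphic if there is a bijection $f:V_1\to V_2$ with the $(i,j)$ entry of $A_1$ equal to the $(f(i),f(j))$ entry of $A_2$. If $M=\begin{pmatrix} A & B\\ C & D\end{pmatrix}$ with rows/columns indexed by $Y$ and $V\setminus Y$ and $A=M[Y]$ nonsingular, the Schur complement is $(M/A)=D-CA^{-1}B$ (if $Y=\emptyset$, $(M/A)=M$). A rank-decomposition of a $V\times V$ matrix $A$ is a pair $(T,\mathcal L)$ of a subcubic tree $T$ and a bijection $\mathcal L$ from $V$ to the leaves of $T$; the width of an edge $e$ is $\operatorname{rk} A[\mathcal L^{-1}(X_e),\mathcal L^{-1}(Y_e)]$ where $(X_e,Y_e)$ is the partition of leaves given by the components of $T\setminus e$; the width of the decomposition is the maximum edge width, and the rank-width is the minimum width over all rank-decompositions (0 if $|V|\le 1$). *)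

(* Defs.v *)
From HB Require Import structures.
From mathcomp Require Import all_boot all_order all_algebra.
From mathcomp Require Import boolp.

Set Implicit Arguments.
Unset Strict Implicit.
Unset Printing Implicit Defensive.

Import GRing.Theory.
Local Open Scope ring_scope.

Section Matrices.
Variable F : fieldType.

Definition symmetric_matrix n (A : 'M[F]_n) : Prop := A = A^T.

(* The vanishing diagonal is a separate requirement because of
   characteristic 2. *)
Definition skew_symmetric_matrix n (A : 'M[F]_n) : Prop :=
  A = - A^T /\ forall i, A i i = 0.

Definition matrix_isomorphic m n (A : 'M[F]_m) (B : 'M[F]_n) : Prop :=
  exists f : 'I_m -> 'I_n, bijective f /\ forall i j, A i j = B (f i) (f j).

(* A[X, Y]; rows and columns are renumbered along the increasing enumerations
   of X and Y. *)
Definition submatrix n (A : 'M[F]_n) (X Y : {set 'I_n}) : 'M[F]_(#|X|, #|Y|) :=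
  \matrix_(i, j) A (enum_val i) (enum_val j).

Definition principal_submatrix n (A : 'M[F]_n) (Y : {set 'I_n}) : 'M[F]_#|Y| :=
  submatrix A Y Y.

(* (M / M[Y]); meaningful when M[Y] is nonsingular. *)
Definition schur_complement n (M : 'M[F]_n) (Y : {set 'I_n}) :
    'M[F]_#|~: Y| :=
  submatrix M (~: Y) (~: Y) -
    submatrix M (~: Y) Y *m invmx (principal_submatrix M Y) *m
      submatrix M Y (~: Y).

End Matrices.

Section Trees.
Variables (T : finType) (e : rel T).

Definition degree (x : T) : nat := #|[set y | e x y]|.

Definition is_leaf (x : T) : bool := degree x == 1%N.

Definition is_tree : Prop :=
  [/\ (0 < #|T|)%N, symmetric e, irreflexive e,
      (forall x y, connect e x y)
    & (forall c : seq T, ucycle e c -> (size c <= 2)%N)].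

Definition is_subcubic_tree : Prop :=
  is_tree /\ forall x, (degree x <= 3)%N.

Definition delete_edge (u v : T) : rel T :=
  fun x y => [&& e x y, (x, y) != (u, v) & (x, y) != (v, u)].

End Trees.

Record rank_decomposition (n : nat) : Type := RankDecomposition {
  rd_vertex : finType;
  rd_adj : rel rd_vertex;
  rd_subcubic : is_subcubic_tree rd_adj;
  rd_leaf : 'I_n -> {x : rd_vertex | is_leaf rd_adj x};
  rd_leaf_bij : bijective rd_leaf
}.

Section RankWidth.
Variables (F : fieldType) (n : nat).

(* The indices whose leaf lies in the component of u in T \ uv. *)
Definition edge_side (D : rank_decomposition n) (u v : rd_vertex D) :
    {set 'I_n} :=
  [set i | connect (delete_edge (@rd_adj n D) u v) u (val (rd_leaf D i))].

Definition edge_width (A : 'M[F]_n) (D : rank_decomposition n)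
    (u v : rd_vertex D) : nat :=
  \rank (submatrix A (edge_side u v) (edge_side v u)).

(* Each edge is visited in both orientations; the two ranks agree for symmetric
   and for skew-symmetric A. *)
Definition decomposition_width (A : 'M[F]_n) (D : rank_decomposition n) : nat :=
  (\max_(p : rd_vertex D * rd_vertex D | @rd_adj n D p.1 p.2)
     edge_width A p.1 p.2)%N.

End RankWidth.

(* A tree may be presented by a parent map that strictly decreases a rank. *)
Section ParentTree.
Variables (T : finType) (p : T -> T) (r : T -> nat) (root : T).
Hypothesis rP : forall x, x != root -> (r (p x) < r x)%N.
Hypothesis pr : p root = root.

Definition parent_adj : rel T :=
  fun x y => (x != y) && ((p x == y) || (p y == x)).

Lemma parent_adj_sym : symmetric parent_adj.
Proof. by move=> x y; rewrite /parent_adj eq_sym orbC. Qed.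

Lemma parent_adj_lower x y : parent_adj x y -> (r y <= r x)%N -> p x = y.
Proof.
case/andP=> xy /orP[/eqP // | /eqP yx] le.
have y0 : y != root.
  by apply: contraNneq xy => y0; rewrite -yx y0 pr.
by have := rP y0; rewrite yx ltnNge le.
Qed.

Lemma parent_adj_tree : is_tree parent_adj.
Proof.
have csym : connect_sym parent_adj.
  exact: sym_connect_sym parent_adj_sym.
have toroot x : connect parent_adj x root.
  have [m] := ubnP (r x); elim: m x => // m IH x lt.
  have [-> // | x0] := eqVneq x root.
  have lt' := rP x0.
  apply: connect_trans (IH (p x) _); last exact: leq_trans lt' _.
  apply: connect1; rewrite /parent_adj eqxx andbT.
  by apply: contraTneq lt' => <-; rewrite ltnn.
split.
- by apply/card_gt0P; exists root.
- exact: parent_adj_sym.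
- by move=> x; rewrite /parent_adj eqxx.
- by move=> x y; apply: connect_trans (toroot x) _; rewrite csym.
move=> c /andP[cyc uc]; case Ec: c => [//|x0 s]; rewrite -Ec.
have x0c : x0 \in c by rewrite Ec mem_head.
have [x xc xmax] : exists2 x, x \in c & forall y, y \in c -> (r y <= r x)%N.
  by case: (arg_maxnP r x0c) => x xc H; exists x => // y /H.
have nx : p x = next c x.
  by apply: parent_adj_lower; [exact: next_cycle | apply: xmax; rewrite mem_next].
have px : p x = prev c x.
  apply: parent_adj_lower; last by apply: xmax; rewrite mem_prev.
  by rewrite parent_adj_sym; exact: prev_cycle.
have nn : next c (next c x) = x by rewrite -nx px next_prev.
have [i c' Hrot] := rot_to xc.
have nrot y : next c y = next (x :: c') y by rewrite -Hrot next_rot.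
have {uc} uc : uniq (x :: c') by rewrite -Hrot rot_uniq.
rewrite -(size_rot i) Hrot.
case: c' {Hrot} nrot uc => [//|a [//|b c']] nrot.
move: nn; rewrite !nrot /= !eqxx.
by case: eqP => [-> | _] => [_ | ->]; rewrite /= !inE eqxx ?orbT.
Qed.

End ParentTree.

(* Any two or more indices can be placed at the leaves of a caterpillar: a path
   (i, false) with a pendant vertex (i, true) attached to each of its vertices. *)
Section Caterpillar.
Variable m : nat.
Local Notation n := m.+2.
Local Notation V := ('I_n * bool)%type.

Definition caterpillar_parent (x : V) : V :=
  if x.2 then (x.1, false) else (inord x.1.-1, false).

Local Notation cat := (parent_adj caterpillar_parent).

Lemma caterpillar_tree : is_tree cat.
Proof.
apply: (@parent_adj_tree _ _ (fun x : V => x.1.*2 + x.2)%N (ord0, false)).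
- case=> i [] /=; rewrite /caterpillar_parent /= => ni.
    by rewrite addn0 addn1.
  have i0 : (0 < i)%N.
    rewrite lt0n; apply: contraNneq ni => i0.
    by apply/eqP; congr pair; apply: val_inj.
  rewrite !addn0 ltn_double inordK ?ltn_predL //.
  exact: leq_ltn_trans (leq_pred _) (ltn_ord i).
- by congr pair; apply: val_inj; rewrite /= inordK.
Qed.

Lemma caterpillar_true i : [set y | cat (i, true) y] = [set (i, false)].
Proof.
apply/setP=> -[j b]; rewrite !inE /parent_adj /caterpillar_parent /=.
by case: b; rewrite !xpair_eqE /= ?andbF ?andbT ?orbF 1?eq_sym.
Qed.

Lemma caterpillar_leaf (x : V) : is_leaf cat x = x.2.
Proof.
case: x => i [] /=; first by rewrite /is_leaf /degree caterpillar_true cards1.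
apply/negbTE; rewrite /is_leaf /degree neq_ltn; apply/orP; right.
pose j : 'I_n := if (i : nat) == 0%N then inord 1 else inord i.-1.
have H : [set (i, true); (j, false)] \subset [set y | cat (i, false) y].
  apply/subsetP=> y; rewrite !inE => /orP[] /eqP ->.
    by rewrite /parent_adj /caterpillar_parent !xpair_eqE /= ?eqxx ?andbF ?orbT.
  rewrite /parent_adj /caterpillar_parent !xpair_eqE /= ?andbT /j.
  case: (eqVneq (i : nat) 0%N) => [i0 | ]; last first.
    rewrite -lt0n => i0; rewrite eqxx andbT -val_eqE /= inordK; last first.
      exact: leq_ltn_trans (leq_pred _) (ltn_ord i).
    by rewrite neq_ltn ltn_predL i0 orbT.
  rewrite -!val_eqE /= !inordK //= ?i0 //.
by apply: leq_trans (subset_leq_card H); rewrite cards2 xpair_eqE andbF.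
Qed.

Lemma caterpillar_subcubic : is_subcubic_tree cat.
Proof.
split; first exact: caterpillar_tree.
case=> i [] ; rewrite /degree; first by rewrite caterpillar_true cards1.
have H : [set y | cat (i, false) y] \subset
    [set (i, true); (inord i.-1, false); (inord i.+1, false)].
  apply/subsetP=> -[j b]; rewrite !inE /parent_adj /caterpillar_parent.
  rewrite !xpair_eqE /=; case: b => /=; rewrite ?andbF ?andbT ?orbF /=.
    by rewrite xpair_eqE => /andP[].
  rewrite xpair_eqE andbT.
  case/andP=> ij /orP[/eqP -> | /eqP Ej]; first by rewrite eqxx.
  have vi : (i : nat) = j.-1.
    rewrite -Ej inordK //.
    exact: leq_ltn_trans (leq_pred _) (ltn_ord j).
  have j0 : (0 < j)%N.
    by rewrite lt0n; apply: contraNneq ij => j0; rewrite -val_eqE /= vi j0.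
  by apply/orP; right; rewrite -val_eqE /= vi prednK // inordK.
apply: leq_trans (subset_leq_card H) _.
apply: leq_trans (leq_card_setU _ _) _.
by rewrite cards1 addn1 ltnS cards2; case: (_ != _).
Qed.

Definition caterpillar_label (i : 'I_n) : {x : V | is_leaf cat x} :=
  exist _ (i, true) (caterpillar_leaf (i, true)).

Lemma caterpillar_label_bij : bijective caterpillar_label.
Proof.
exists (fun x => (val x).1) => // -[[i b] H]; apply: val_inj => /=.
by move: (H); rewrite caterpillar_leaf /= => ->.
Qed.

Definition caterpillar : rank_decomposition n :=
  RankDecomposition caterpillar_subcubic caterpillar_label_bij.

End Caterpillar.

Section RankWidthDef.
Variables (F : fieldType) (n : nat) (A : 'M[F]_n).

Definition rank_width_candidate (w : nat) : bool :=
  if (n <= 1)%N then w == 0%N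
  else `[< exists D : rank_decomposition n, decomposition_width A D = w >].

Lemma rank_width_candidate_ex : exists w, rank_width_candidate w.
Proof.
rewrite /rank_width_candidate; case: leqP => [_ | n1]; first by exists 0%N.
have D : rank_decomposition n.
  by case: n n1 => [//|[//|m]] _; exact: caterpillar.
by exists (decomposition_width A D); apply/asboolP; exists D.
Qed.

Definition rank_width : nat := ex_minn rank_width_candidate_ex.

End RankWidthDef.

(* Main.v *)
(** The chains of a matrix M are the pairs (z, M z). For a set X of indices, compare
    the restrictions to X of all chains with the chains supported in X: when M is
    symmetric or skew-symmetric, the quotient has dimension twice the cut-rank of X.
    So, for bounded cut-rank, its elements are labelled by one fixed finite set of
    boundaries, and how the restrictions to two disjoint sets fit together depends on
    the boundaries only. A minor arises by imposing x = 0 (deletion) or y = 0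
    (contraction) at the other indices of a chain (x, y).

    A decomposition tree is linked if between two comparable nodes of the same
    cut-rank, joined by nodes of no smaller cut-rank, there is no smaller cut. Otherwise
    uncrossing the tree along a smallest cut separates a pair of nodes; a tree with
    lexicographically least numbers of pairs joined by cut-ranks at least j, for j
    from the width down to 0, is therefore linked. If X is a subset of Y, with the
    same cut-rank and no smaller cut in between, Tutte's linking theorem yields
    deletions and contractions in Y - X that turn the restrictions of chains to Y into
    those to X, up to a permutation of the boundaries.

    Well-quasi-ordering is proved by descending induction on a cut-rank s. In a
    minimal bad sequence of trees with root of cut-rank s, built from nodes of
    cut-rank at least s, the subtrees of root cut-rank s joined to the root are minors of
    the tree by linkedness, hence well-quasi-ordered by minimality; above them only
    cut-ranks greater than s occur. The permutations of boundaries form a finite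
    group, so they can be made trivial along a subsequence. For X the set of all
    indices the only boundary is 0, and contracting a set amounts to a Schur
    complement. *)

Require Import Defs.
From Corelib Require Import RelationClasses.
From mathcomp Require Import all_boot all_order all_algebra all_fingroup.
From mathcomp Require Import boolp zify.

Set Implicit Arguments.
Unset Strict Implicit.
Unset Printing Implicit Defensive.

Import GRing.Theory.

Definition indic_mx (R : pzRingType) n (X : {set 'I_n}) : 'M[R]_n :=
  diag_mx (\row_i (i \in X)%:R)%R.
Arguments indic_mx {R n} X.
Local Notation "\I_ X" := (indic_mx X) (at level 8, X at level 2, format "\I_ X").

Section IndicatorMatrix.
Variables (R : comPzRingType) (n : nat).
Local Open Scope ring_scope.
Implicit Types (X Y : {set 'I_n}).

Lemma mul_indic_mxE X p (A : 'M[R]_(n, p)) i j :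
  (\I_X *m A) i j = if i \in X then A i j else 0.
Proof. by rewrite mul_diag_mx !mxE; case: (i \in X); rewrite ?mul1r ?mul0r. Qed.

Lemma indic_mxE X i j : (\I_X : 'M[R]_n) i j = ((i == j) && (i \in X))%:R.
Proof.
by rewrite -[\I_X]mulmx1 mul_indic_mxE mxE; case: ifP; rewrite ?andbT ?andbF.
Qed.

Lemma eq_mul_indic_mx X (x y : 'cV[R]_n) :
  \I_X *m x = \I_X *m y <-> {in X, forall i, x i 0 = y i 0}.
Proof.
split=> [/matrixP xy i iX | xy].
  by have := xy i 0; rewrite !mul_indic_mxE iX.
by apply/matrixP=> i j; rewrite !mul_indic_mxE ord1; case: ifP => // /xy.
Qed.

Lemma mul_indic_mx_eq0 X (x : 'cV[R]_n) :
  \I_X *m x = 0 <-> {in X, forall i, x i 0 = 0}.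
Proof.
rewrite -[X in _ = X](mulmx0 _ \I_X) eq_mul_indic_mx.
by split=> x0 i /x0; rewrite mxE.
Qed.

Lemma tr_indic_mx X : (\I_X : 'M[R]_n)^T = \I_X.
Proof. exact: tr_diag_mx. Qed.

Lemma mul_indic_mx X Y : \I_X *m \I_Y = \I_(X :&: Y) :> 'M[R]_n.
Proof.
apply/matrixP=> i j; rewrite mul_indic_mxE !indic_mxE inE.
by case: (i \in X); rewrite ?andbF.
Qed.

Lemma indic_mxSl X Y : X \subset Y -> \I_X *m \I_Y = \I_X :> 'M[R]_n.
Proof. by move=> /setIidPl; rewrite mul_indic_mx => ->. Qed.

Lemma indic_mxSr X Y : X \subset Y -> \I_Y *m \I_X = \I_X :> 'M[R]_n.
Proof. by move=> /setIidPr; rewrite mul_indic_mx => ->. Qed.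

Lemma indic_mx0 : \I_set0 = 0 :> 'M[R]_n.
Proof. by apply/matrixP=> i j; rewrite indic_mxE mxE inE andbF. Qed.

Lemma indic_mxT : \I_setT = 1%:M :> 'M[R]_n.
Proof. by apply/matrixP=> i j; rewrite indic_mxE mxE inE andbT. Qed.

Lemma indic_mxU X Y : [disjoint X & Y] -> \I_(X :|: Y) = \I_X + \I_Y :> 'M[R]_n.
Proof.
move=> dXY; apply/matrixP=> i j; rewrite [RHS]mxE !indic_mxE inE.
case: eqP => //= _; rewrite ?addr0 //.
by case: (boolP (i \in X)) => [/(disjointFr dXY) -> | _]; rewrite ?addr0 ?add0r.
Qed.

Lemma indic_mxC X : \I_X + \I_(~: X) = 1%:M :> 'M[R]_n.
Proof. by rewrite -indic_mxU ?setUCr ?indic_mxT // disjoints_subset setCK. Qed.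

Lemma tr_mul_indic_mx (M : 'M[R]_n) (eps : R) X Y : M^T = eps *: M ->
  (\I_X *m M *m \I_Y)^T = eps *: (\I_Y *m M *m \I_X).
Proof.
by move=> symM; rewrite !trmx_mul !tr_indic_mx symM -scalemxAl -scalemxAr mulmxA.
Qed.

Lemma mul_indic_disjoint X Y : [disjoint X & Y] -> \I_X *m \I_Y = 0 :> 'M[R]_n.
Proof. by rewrite mul_indic_mx -setI_eq0 => /eqP ->; exact: indic_mx0. Qed.

End IndicatorMatrix.

Section Submatrix.
Variables (F : fieldType) (n : nat).
Local Open Scope ring_scope.
Implicit Types (M : 'M[F]_n) (X Y : {set 'I_n}).

Definition row_selector X : 'M[F]_(#|X|, n) := rowsub enum_val 1%:M.

Lemma submatrixE M X Y :
  submatrix M X Y = row_selector X *m M *m (row_selector Y)^T.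
Proof.
rewrite -rowsubE trmx_mxsub trmx1 mulmx_colsub mulmx1 -mxsubcr.
by apply/matrixP=> i j; rewrite !mxE.
Qed.

Lemma mul_row_selector_tr X : row_selector X *m (row_selector X)^T = 1%:M.
Proof.
rewrite trmx_mxsub trmx1 mulmx_colsub mulmx1.
by apply/matrixP=> i j; rewrite !mxE (inj_eq enum_val_inj).
Qed.

Lemma mul_tr_row_selector X : (row_selector X)^T *m row_selector X = \I_X.
Proof.
apply/matrixP=> i j; rewrite [LHS]mxE indic_mxE.
under eq_bigr => a _ do rewrite !mxE.
have [iX|niX] := boolP (i \in X); last first.
  rewrite big1 ?andbF // => a _.
  rewrite (_ : (_ == i) = false) ?mul0r //.
  by apply: contraNF niX => /eqP <-; exact: enum_valP.
rewrite (bigD1 (enum_rank_in iX i)) //= enum_rankK_in // eqxx mul1r andbT.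
rewrite big1 ?addr0 // => a; rewrite -(inj_eq enum_val_inj) enum_rankK_in //.
by move/negbTE->; rewrite mul0r.
Qed.

Lemma row_selector_free X : row_free (row_selector X).
Proof. by apply/row_freeP; exists (row_selector X)^T; exact: mul_row_selector_tr. Qed.

Lemma tr_row_selector_full X : row_full (row_selector X)^T.
Proof. by rewrite /row_full mxrank_tr; exact: row_selector_free. Qed.

Lemma rank_submatrix M X Y : \rank (submatrix M X Y) = \rank (\I_X *m M *m \I_Y).
Proof.
rewrite submatrixE -!mul_tr_row_selector mulmxA [RHS]mxrankMfree ?row_selector_free //.
by rewrite -!mulmxA [RHS]eqmxMfull ?tr_row_selector_full.
Qed.

Lemma rank_indic_mx X : \rank (\I_X : 'M[F]_n) = #|X|.
Proof.
rewrite -mul_tr_row_selector eqmxMfull ?tr_row_selector_full //.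
exact/eqP/row_selector_free.
Qed.

End Submatrix.

(** * Cut-rank and linking *)

Section BlockRank.
Variables (F : fieldType) (n : nat) (M : 'M[F]_n).
Local Open Scope ring_scope.
Implicit Types (A B X Y : {set 'I_n}).

Definition block_rank A B : nat := \rank (\I_A *m M *m \I_B).

Lemma block_rankS A A' B B' :
  A \subset A' -> B \subset B' -> (block_rank A B <= block_rank A' B')%N.
Proof.
move=> sA sB; rewrite /block_rank.
have -> : \I_A *m M *m \I_B = \I_A *m (\I_A' *m M *m \I_B') *m \I_B.
  by rewrite !mulmxA indic_mxSl // -!mulmxA indic_mxSr.
exact: leq_trans (mxrankM_maxl _ _) (mxrankM_maxr _ _).
Qed.

(* Up to a shift, the rank of a block is the dimension of a space that is monotone
   in its row set and antitone in its column set. *)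
Lemma rank_adds_indic A B :
  \rank (\I_A *m M + \I_(~: B))%MS = (block_rank A B + #|~: B|)%N.
Proof.
have -> : (\I_A *m M + \I_(~: B) :=: \I_A *m M *m \I_B + \I_(~: B))%MS.
  have decM : \I_A *m M = \I_A *m M *m \I_B + \I_A *m M *m \I_(~: B).
    by rewrite -mulmxDr indic_mxC mulmx1.
  apply/eqmxP; rewrite !addsmx_sub !addsmxSr !andbT; apply/andP; split.
    rewrite [X in (X <= _)%MS]decM addmx_sub ?addsmxSl //.
    exact: submx_trans (submxMl _ _) (addsmxSr _ _).
  rewrite -[X in (X <= _)%MS](addrK (\I_A *m M *m \I_(~: B))) -decM.
  rewrite addmx_sub ?addsmxSl //.
  by rewrite eqmx_opp; exact: submx_trans (submxMl _ _) (addsmxSr _ _).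
rewrite mxrank_disjoint_sum ?rank_indic_mx //.
apply/eqP; rewrite -submx0; apply/rV_subP=> u; rewrite sub_capmx.
case/andP=> /submxP[C ->] /submxP[D /(congr1 (mulmx^~ \I_B))].
rewrite -!mulmxA [\I_(~: B) *m _]mul_indic_disjoint ?disjoints_subset ?subsetDr //.
by rewrite indic_mxSl // !mulmxA mulmx0 => ->; exact: sub0mx.
Qed.

Lemma block_rank_submod A1 A2 B1 B2 :
  (block_rank (A1 :&: A2) (B1 :|: B2) + block_rank (A1 :|: A2) (B1 :&: B2)
     <= block_rank A1 B1 + block_rank A2 B2)%N.
Proof.
pose U A B := (\I_A *m M + \I_(~: B))%MS.
have indic_sub X Y : X \subset Y -> (\I_X <= (\I_Y : 'M[F]_n))%MS.
  by move=> sXY; rewrite -(indic_mxSl _ sXY) submxMl.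
have indicU_sub X Y : (\I_(X :|: Y) <= (\I_X : 'M[F]_n) + (\I_Y : 'M[F]_n))%MS.
  rewrite -[(X :|: Y)%SET]setTI -(setUCr X) -setUIr indic_mxU; last first.
    by rewrite disjoints_subset setCI setCK subsetUl.
  by rewrite -mul_indic_mx addmx_sub_adds ?submxMl.
have cap : (U (A1 :&: A2)%SET (B1 :|: B2)%SET <= U A1 B1 :&: U A2 B2)%MS.
  rewrite sub_capmx !addsmxS ?submxMr ?indic_sub ?setCS //;
  by rewrite ?subsetIl ?subsetIr ?subsetUl ?subsetUr.
have sum : (U (A1 :|: A2)%SET (B1 :&: B2)%SET <= U A1 B1 + U A2 B2)%MS.
  rewrite [X in (_ <= X)%MS]Monoid.mulmACA /U setCI addsmxS ?indicU_sub //.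
  by rewrite -addsmxMr submxMr.
have := leq_add (mxrankS cap) (mxrankS sum).
rewrite [leqRHS]addnC mxrank_sum_cap !rank_adds_indic.
have := cardsUI (~: B1) (~: B2); rewrite -setCI -setCU; lia.
Qed.

Lemma block_rank_tr (eps : F) A B : eps != 0 -> M^T = eps *: M ->
  block_rank B A = block_rank A B.
Proof.
move=> eps0 symM.
by rewrite /block_rank -mxrank_tr (tr_mul_indic_mx _ _ symM) mxrank_scale_nz.
Qed.

Definition cutrank X : nat := block_rank X (~: X).

Lemma cutrank_submod X Y :
  (cutrank (X :&: Y) + cutrank (X :|: Y) <= cutrank X + cutrank Y)%N.
Proof. by rewrite /cutrank setCI setCU; exact: block_rank_submod. Qed.

Lemma cutrank0 : cutrank set0 = 0%N.
Proof. by rewrite /cutrank /block_rank indic_mx0 !mul0mx mxrank0. Qed.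

Lemma cutrankT : cutrank setT = 0%N.
Proof. by rewrite /cutrank /block_rank setCT indic_mx0 mulmx0 mxrank0. Qed.

Lemma cutrankC (eps : F) X : eps != 0 -> M^T = eps *: M -> cutrank (~: X) = cutrank X.
Proof. by move=> eps0 symM; rewrite /cutrank setCK (block_rank_tr _ _ eps0 symM). Qed.

End BlockRank.

Section Linking.
Variables (V : finType) (r : {set V} -> {set V} -> nat).
Implicit Types (A B W X Y Z S : {set V}).
Hypothesis r_leqS : forall A A' B B',
  A \subset A' -> B \subset B' -> r A B <= r A' B'.
Hypothesis r_submod : forall A1 A2 B1 B2,
  r (A1 :&: A2) (B1 :|: B2) + r (A1 :|: A2) (B1 :&: B2) <= r A1 B1 + r A2 B2.

(* Tutte's linking theorem: an element [v] of [W] is either dropped, or moved to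
   both sides; were both choices obstructed, say by [Z1] and [Z2], submodularity
   would contradict the hypothesis at [Z1 :&: Z2] or at [v |: (Z1 :|: Z2)]. *)
Lemma exists_linking_set kappa X Y W :
    (forall Z, Z \subset W -> kappa <= r (X :|: Z) (Y :|: W :\: Z)) ->
  exists2 S : {set V}, S \subset W & kappa + #|S| <= r (X :|: S) (Y :|: S).
Proof.
have [m] := ubnP #|W|; elim: m kappa X Y W => // m IH kappa X Y W ltWm cutW.
have [W0|[v vW]] := set_0Vmem W.
  exists set0; rewrite ?sub0set // cards0 addn0.
  by have := cutW set0 (sub0set _); rewrite W0 setD0.
have ltW'm : #|W :\ v| < m by move: ltWm; rewrite (cardsD1 v W) vW.
have sW'W := subD1set W v.
have [/IH[] // S sS linkS|/existsNP[Z1 /not_implyP[sZ1 /negP]]] :=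
    pselect (forall Z, Z \subset W :\ v -> kappa <= r (X :|: Z) (Y :|: W :\ v :\: Z)).
  by exists S => //; exact: subset_trans sW'W.
rewrite -ltnNge => ltZ1.
have [/IH[] // S sS linkS|/existsNP[Z2 /not_implyP[sZ2 /negP]]] :=
    pselect (forall Z, Z \subset W :\ v ->
      kappa.+1 <= r (v |: X :|: Z) (v |: Y :|: W :\ v :\: Z)).
  have vS : v \notin S by apply/negP=> /(subsetP sS); rewrite !inE eqxx.
  exists (v |: S); first by rewrite subUset sub1set vW (subset_trans sS).
  by rewrite cardsU1 vS add1n addnS -addSn !(setUCA _ [set v]) !setUA.
rewrite -ltnNge => ltZ2.
have [sZ1W sZ2W] := (subset_trans sZ1 sW'W, subset_trans sZ2 sW'W).
have leI : kappa <= r ((X :|: Z1) :&: (v |: X :|: Z2))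
    ((Y :|: W :\ v :\: Z1) :|: (v |: Y :|: W :\ v :\: Z2)).
  apply: leq_trans (cutW (Z1 :&: Z2) (subset_trans (subsetIl _ _) sZ1W)) (r_leqS _ _);
  apply/subsetP=> i; rewrite !inE.
    by case: (i \in X) (i \in Z1) (i \in Z2) => [] [] []; rewrite ?orbT.
  by case: (i == v) (i \in Y) (i \in W) (i \in Z1) (i \in Z2) => [] [] [] [] [].
have leU : kappa <= r ((X :|: Z1) :|: (v |: X :|: Z2))
    ((Y :|: W :\ v :\: Z1) :&: (v |: Y :|: W :\ v :\: Z2)).
  apply: leq_trans (cutW (v |: (Z1 :|: Z2)) _) (r_leqS _ _).
  - by rewrite !subUset sub1set vW sZ1W.
  - apply/subsetP=> i; rewrite !inE.
    by case: (i == v) (i \in X) (i \in Z1) (i \in Z2) => [] [] [] [].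
  - apply/subsetP=> i; rewrite !inE.
    by case: (i == v) (i \in Y) (i \in W) (i \in Z1) (i \in Z2) => [] [] [] [] [].
have := leq_trans (leq_add leI leU) (r_submod _ _ _ _); lia.
Qed.

End Linking.

(** * Well-quasi-orders *)

Section WellQuasiOrder.
Variable T : Type.
Implicit Types (P Q : T -> Prop) (le : T -> T -> Prop) (f : nat -> T).

Definition wqo P le : Prop :=
  forall f, (forall i, P (f i)) -> exists i j, i < j /\ le (f i) (f j).

Definition infinitely_often (A : nat -> Prop) : Prop :=
  forall N, exists2 i, N <= i & A i.

Lemma iterate_increasing (next : nat -> nat) N : (forall i, N <= i -> i < next i) ->
  {homo (fun m => iter m next N) : i j / i < j}.
Proof.
move=> next_gt; have geN m : N <= iter m next N.
  by elim: m => //= m IH; exact: leq_trans IH (ltnW (next_gt _ IH)).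
by apply: (homo_ltn ltn_trans) => m /=; exact: next_gt.
Qed.

Lemma infinitely_often_subseq (A : nat -> Prop) : infinitely_often A ->
  exists2 g : nat -> nat, {homo g : i j / i < j} & forall i, A (g i).
Proof.
move=> infA; have ex_next N : exists i, N < i /\ A i by have [i] := infA N.+1; exists i.
have [next nextP] := choice ex_next.
exists (fun m => iter m.+1 next 0) => [i j ij|i]; last by case: (nextP (iter i next 0)).
by apply: (iterate_increasing (N := 0)) => // m _; case: (nextP m).
Qed.

Lemma wqo_chain P le f : Transitive le -> wqo P le -> (forall i, P (f i)) ->
  exists2 g : nat -> nat, {homo g : i j / i < j} &
    {homo f \o g : i j / i < j >-> le i j}.
Proof.
move=> le_trans wqoP Pf; pose stuck i := forall j, i < j -> ~ le (f i) (f j).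
have [inf_stuck|/existsNP[N no_stuck]] := pselect (infinitely_often stuck).
  have [g g_incr g_stuck] := infinitely_often_subseq inf_stuck.
  have [i [j [ij leij]]] := wqoP (f \o g) (fun i => Pf _).
  by case: (g_stuck i (g j) (g_incr _ _ ij)).
have ex_next i : exists j, N <= i -> i < j /\ le (f i) (f j).
  have [leNi|ltiN] := leqP N i; last by exists 0.
  have /existsNP[j /not_implyP[ij /contrapT leij]] : ~ stuck i.
    by move=> si; apply: no_stuck; exists i.
  by exists j.
have [next nextP] := choice ex_next; pose g m := iter m next N.
have g_incr : {homo g : i j / i < j}.
  by apply: iterate_increasing => i /nextP[].
exists g => //; apply: homo_ltn => [y x z|m /=]; first exact: le_trans.
have /nextP[] // : N <= g m by case: m => // m; exact/ltnW/(g_incr 0).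
Qed.

Lemma wqo_sub P Q le : (forall x, P x -> Q x) -> wqo Q le -> wqo P le.
Proof. by move=> PQ wqoQ f Pf; apply: wqoQ => i; exact: PQ. Qed.

Lemma wqo_weaken P le le' : wqo P le ->
  (forall x y, P x -> P y -> le x y -> le' x y) -> wqo P le'.
Proof.
move=> wqoP le_le' f Pf; have [i [j [ij leij]]] := wqoP f Pf.
by exists i, j; split=> //; exact: le_le'.
Qed.

Lemma wqo_or P Q le : wqo P le -> wqo Q le -> wqo (fun x => P x \/ Q x) le.
Proof.
move=> wqoP wqoQ f PQf.
have [infP|/existsNP[N notP]] := pselect (infinitely_often (fun i => P (f i))).
  have [g g_incr Pg] := infinitely_often_subseq infP.
  have [i [j [ij leij]]] := wqoP (f \o g) Pg.
  by exists (g i), (g j); split; first exact: g_incr.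
have Qf i : Q (f (N + i)).
  by case: (PQf (N + i)) => // Pfi; case: notP; exists (N + i); first exact: leq_addr.
have [i [j [ij leij]]] := wqoQ (fun i => f (N + i)) Qf.
by exists (N + i), (N + j); rewrite ltn_add2l.
Qed.

Lemma wqo_and P le le' : Transitive le ->
  wqo P le -> wqo P le' -> wqo P (fun x y => le x y /\ le' x y).
Proof.
move=> le_trans wqo_le wqo_le' f Pf.
have [g g_incr g_chain] := wqo_chain le_trans wqo_le Pf.
have [i [j [ij leij]]] := wqo_le' (f \o g) (fun i => Pf _).
by exists (g i), (g j); split; [exact: g_incr|split=> //; exact: g_chain].
Qed.

Lemma wqo_finite_color (C : finType) (c : T -> C) P : wqo P (fun x y => c x = c y).
Proof.
move=> f _; pose c' (i : 'I_#|C|.+1) := c (f i).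
have /injectivePn[i [j ij cij]] : ~~ injectiveb c'.
  by apply/negP=> /injectiveP/leq_card; rewrite card_ord ltnn.
have [lt|lt|/val_inj eq_ij] := ltngtP i j; first by exists i, j.
  by exists j, i.
by rewrite eq_ij eqxx in ij.
Qed.

Definition bad_sequence P le f : Prop :=
  (forall i, P (f i)) /\ forall i j, i < j -> ~ le (f i) (f j).

(* Chosen greedily: [f i] has least size among the bad sequences that start with
   [f 0], ..., [f (i - 1)]. *)
Lemma minimal_bad_sequence P le (size : T -> nat) : ~ wqo P le ->
  exists2 f, bad_sequence P le f & forall i h, bad_sequence P le h ->
    (forall j, j < i -> h j = f j) -> size (f i) <= size (h i).
Proof.
move=> /existsNP[f0 /not_implyP[Pf0 badf0]].
have {Pf0 badf0}bad0 : bad_sequence P le f0.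
  by split=> // i j ij leij; apply: badf0; exists i, j.
pose least_at i h h' := [/\ bad_sequence P le h', forall j, j < i -> h' j = h j &
  forall g, bad_sequence P le g -> (forall j, j < i -> g j = h j) ->
    size (h' i) <= size (g i)].
have ex_least (p : nat * (nat -> T)) :
    exists h', bad_sequence P le p.2 -> least_at p.1 p.2 h'.
  case: p => i h; have [bh|nbh] := pselect (bad_sequence P le h); last by exists h.
  pose attained m := `[< exists2 h', bad_sequence P le h' &
    (forall j, j < i -> h' j = h j) /\ size (h' i) = m >].
  have ex_attained : exists m, attained m.
    by exists (size (h i)); apply/asboolP; exists h.
  case: (ex_minnP ex_attained) => m /asboolP[h' bh' [eqh' <-]] minm.
  by exists h' => _; split=> // g bg eqg; apply: minm; apply/asboolP; exists g.
have [next nextP] := choice ex_least.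
pose fix seqs n := if n is m.+1 then next (m, seqs m) else f0.
have bad_seqs n : bad_sequence P le (seqs n).
  by elim: n => // n IH; case: (nextP (n, seqs n) IH).
have eq_seqs m n : m <= n -> forall j, j < m -> seqs n j = seqs m j.
  elim: n => [|n IH]; first by rewrite leqn0 => /eqP ->.
  rewrite leq_eqVlt => /orP[/eqP -> //|]; rewrite ltnS => mn j jm.
  rewrite -(IH mn j jm); case: (nextP (n, seqs n) (bad_seqs n)) => /= _ eq_next _.
  by apply: eq_next; exact: leq_trans mn.
exists (fun i => seqs i.+1 i) => [|i h bh eqh].
  split=> [i|i j ij]; first by case: (bad_seqs i.+1).
  by rewrite -(eq_seqs i.+1 j.+1 (ltnW ij)) //; case: (bad_seqs j.+1) => _; apply.
case: (nextP (i, seqs i) (bad_seqs i)) => /= _ _; apply=> // j ji.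
by rewrite eqh // -(eq_seqs j.+1 i).
Qed.

(* Nash-Williams' argument: replacing a tail of a minimal bad sequence by a bad
   sequence of smaller elements would contradict minimality. *)
Lemma wqo_nash_williams P le sub (size : T -> nat) :
    Transitive le ->
    (forall x y, P x -> P y -> sub x y -> le x y /\ size x < size y) ->
    (forall f, (forall i, P (f i)) -> wqo (fun x => P x /\ exists i, sub x (f i)) le ->
       exists i j, i < j /\ le (f i) (f j)) ->
  wqo P le.
Proof.
move=> le_trans subP wqo_of_subs; apply: contrapT => notwqo.
have [f [Pf badf] minf] := minimal_bad_sequence size notwqo.
have [|i [j [ij]]] := wqo_of_subs f Pf; last exact: badf.
move=> h subh; apply: contrapT => badh.
have [idx idxP] := choice (fun n => (subh n).2).
have ex_idx : exists m, `[< exists n, idx n = m >].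
  by exists (idx 0); apply/asboolP; exists 0.
case: (ex_minnP ex_idx) => i0 /asboolP[n0 idx_n0] min_i0.
pose h' j := if j < i0 then f j else h (n0 + (j - i0)).
suff badh' : bad_sequence P le h'.
  have [_ lt_size] := subP _ _ (subh n0).1 (Pf _) (idxP n0); rewrite idx_n0 in lt_size.
  have /(minf i0 h' badh') : forall j, j < i0 -> h' j = f j.
    by move=> j; rewrite /h' => ->.
  by rewrite /h' ltnn subnn addn0 leqNgt lt_size.
split=> [j|j l jl]; rewrite /h'.
  by case: ifP => // _; case: (subh (n0 + (j - i0))).
case: (ltnP l i0) => [li|il]; first by rewrite (ltn_trans jl li); exact: badf.
case: (ltnP j i0) => [ji|ij] le_jl; last first.
  by apply: badh; exists (n0 + (j - i0)), (n0 + (l - i0)); split; first lia.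
have [le_l _] := subP _ _ (subh _).1 (Pf _) (idxP (n0 + (l - i0))).
apply: (badf j _ _ (le_trans _ _ _ le_jl le_l)); apply: leq_trans ji (min_i0 _ _).
by apply/asboolP; exists (n0 + (l - i0)).
Qed.

End WellQuasiOrder.
Arguments wqo_finite_color {T C} c P f _.

Section TwistedWellQuasiOrder.
Variables (B : finType) (T : Type) (le : {perm B} -> T -> T -> Prop).
Local Open Scope group_scope.
Hypothesis le_comp : forall s t x y z, le s x y -> le t y z -> le (s * t) x z.

(* Along an infinite chain two of the finitely many partial products of twists
   agree, and the twist between them is then trivial. *)
Lemma wqo_untwist P : wqo P (fun x y => exists s, le s x y) -> wqo P (le 1).
Proof.
move=> wqoP f Pf.
have twist_trans x y z :
    (exists s, le s x y) -> (exists s, le s y z) -> exists s, le s x z.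
  by move=> [s le_s] [t le_t]; exists (s * t); exact: le_comp le_t.
have [g g_incr g_chain] := wqo_chain twist_trans wqoP Pf.
have [s sP] := choice (fun i => g_chain i i.+1 (ltnSn i)).
pose total m := \prod_(i < m) s i.
have totalS j : total j.+1 = total j * s j by rewrite /total big_ord_recr.
have le_total i j : i < j -> le ((total i)^-1 * total j) (f (g i)) (f (g j)).
  elim: j => // j IH; rewrite totalS ltnS leq_eqVlt => /orP[/eqP <-|/IH leij].
    by rewrite mulKg; exact: sP.
  by rewrite mulgA; exact: le_comp (sP j).
have [i [j [ij total_ij]]] := wqo_finite_color total (fun=> True) id (fun=> I).
exists (g i), (g j); split; first exact: g_incr.
by have := le_total _ _ ij; rewrite total_ij mulVg.
Qed.

End TwistedWellQuasiOrder.

Lemma exists_perm_extending (B : finType) (A : {set B}) (f : B -> B) :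
    {in A &, injective f} ->
  exists s : {perm B}, {in A, s =1 f}.
Proof.
move=> f_inj; have [m] := ubnP #|A|; elim: m A f_inj => // m IH A f_inj ltA.
have [->|[a aA]] := set_0Vmem A; first by exists 1%g => x; rewrite inE.
have [|s sf] := IH (A :\ a) (sub_in2 (subsetP (subD1set A a)) f_inj).
  by move: ltA; rewrite (cardsD1 a) aA.
exists (s * tperm (s a) (f a))%g => x xA; rewrite permM.
have [-> | xa] := eqVneq x a; first exact: tpermL.
have sx : s x = f x by apply: sf; rewrite !inE xa.
rewrite tpermD ?(inj_eq perm_inj) 1?eq_sym // sx.
by apply: contra_neq xa; exact: f_inj.
Qed.

Lemma exists_lex_minimal (A : Type) (P : A -> Prop) (m : nat -> A -> nat) n :
    (exists a, P a) ->
  exists2 a, P a & forall b j, P b -> j < n ->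
    (forall i, i < j -> m i b <= m i a) -> m j a <= m j b.
Proof.
move=> exP; elim: n => [|n [a Pa min_a]]; first by case: exP => a Pa; exists a.
pose attained x :=
  `[< exists2 b, P b & (forall i, i < n -> m i b <= m i a) /\ m n b = x >].
have ex_attained : exists x, attained x by exists (m n a); apply/asboolP; exists a.
case: (ex_minnP ex_attained) => x /asboolP[b Pb [le_ba <-]] min_b.
exists b => // c j Pc; rewrite ltnS leq_eqVlt => /orP[/eqP ->|jn] le_cb.
  apply: min_b; apply/asboolP; exists c => //; split=> // i lt_in.
  exact: leq_trans (le_cb i lt_in) (le_ba i lt_in).
apply: leq_trans (le_ba j jn) (min_a c j Pc jn _) => i ij.
exact: leq_trans (le_cb i ij) (le_ba i (ltn_trans ij jn)).
Qed.

(** * Decomposition trees *)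

(* Leaves carry sets, so that [trim] may empty them and keep the shape of the tree. *)
Inductive dtree (V : finType) : Type :=
  | Leaf of {set V}
  | Node of dtree V & dtree V.

Section DecompositionTrees.
Variable V : finType.
Implicit Types (T U W : dtree V) (X Y Z : {set V}) (p : seq bool).

Fixpoint vertices T : {set V} :=
  match T with
  | Leaf A => A
  | Node l r => vertices l :|: vertices r
  end.

Fixpoint separated T : bool :=
  match T with
  | Leaf A => #|A| <= 1
  | Node l r => [&& [disjoint vertices l & vertices r], separated l & separated r]
  end.

Fixpoint tree_size T : nat :=
  if T is Node l r then (tree_size l + tree_size r).+1 else 0.

Fixpoint node_sets T : seq {set V} :=
  vertices T :: if T is Node l r then node_sets l ++ node_sets r else [::].

Fixpoint trim Z T : dtree V :=
  match T with
  | Leaf A => Leaf (A :&: Z)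
  | Node l r => Node (trim Z l) (trim Z r)
  end.

Lemma vertices_trim Z T : vertices (trim Z T) = vertices T :&: Z.
Proof. by elim: T => //= l -> r ->; rewrite setIUl. Qed.

Lemma trim_id Z T : vertices T \subset Z -> trim Z T = T.
Proof.
elim: T => [A /setIidPl /= -> //|l IHl r IHr] /=.
by rewrite subUset => /andP[/IHl -> /IHr ->].
Qed.

Lemma separated_trim Z T : separated T -> separated (trim Z T).
Proof.
elim: T => [A|l IHl r IHr] /=; first exact/leq_trans/subset_leq_card/subsetIl.
case/and3P=> dlr /IHl -> /IHr ->; rewrite !vertices_trim !andbT.
exact: disjointWl (subsetIl _ _) (disjointWr (subsetIl _ _) dlr).
Qed.

Lemma node_sets_trim Z T : node_sets (trim Z T) = [seq X :&: Z | X <- node_sets T].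
Proof. by elim: T => //= l -> r ->; rewrite !vertices_trim map_cat setIUl. Qed.

Lemma node_set_sub T X : X \in node_sets T -> X \subset vertices T.
Proof.
elim: T => [A|l IHl r IHr] /=; rewrite in_cons => /orP[/eqP -> //|//].
rewrite mem_cat => /orP[/IHl|/IHr] /subset_trans; apply; first exact: subsetUl.
exact: subsetUr.
Qed.

Lemma node_sets_laminar T X Y :
    separated T -> X \in node_sets T -> Y \in node_sets T ->
  [|| X \subset Y, Y \subset X | [disjoint X & Y]].
Proof.
elim: T => [A _|l IHl r IHr] /=.
  by rewrite !inE => /eqP -> /eqP ->; rewrite subxx.
case/and3P=> dlr sepl sepr; have sub Z := @node_set_sub (Node l r) Z.
rewrite in_cons => /predU1P[->|XT] YT; first by rewrite sub ?orbT.
move: YT; rewrite in_cons => /predU1P[->|YT]; first by rewrite sub //= in_cons XT orbT.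
have disj Z Z' : Z \in node_sets l -> Z' \in node_sets r -> [disjoint Z & Z'].
  move=> Zl Zr.
  exact: disjointWl (node_set_sub Zl) (disjointWr (node_set_sub Zr) dlr).
move: XT YT; rewrite !mem_cat => /orP[Xl|Xr] /orP[Yl|Yr].
- exact: IHl.
- by rewrite disj ?orbT.
- by rewrite [[disjoint X & Y]]disjoint_sym disj ?orbT.
- exact: IHr.
Qed.

Definition crosses Z X : bool := (X :&: Z != set0) && (X :\: Z != set0).

Lemma crosses_sub Z X Y : X \subset Y -> crosses Z X -> crosses Z Y.
Proof.
move=> sXY /andP[XZ XDZ]; apply/andP; split.
  by apply: contraNneq XZ => YZ0; rewrite -subset0 -YZ0 setSI.
by apply: contraNneq XDZ => YZ0; rewrite -subset0 -YZ0 setSD.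
Qed.

Lemma crosses_disjoint Z Z' X Y : [disjoint X & Y] -> Z' :\: X = Z :\: X ->
  crosses Z' Y = crosses Z Y.
Proof.
move=> dXY eqZ; have eqYZ A : Y :&: (A :\: X) = Y :&: A /\ Y :\: (A :\: X) = Y :\: A.
  split; apply/setP=> i; rewrite !inE;
  by case: (boolP (i \in Y)) => [/(disjointFl dXY) ->|]; rewrite ?andbF.
have [YZ YDZ] := eqYZ Z; have [YZ' YDZ'] := eqYZ Z'.
by rewrite /crosses -YZ -YDZ -YZ' -YDZ' eqZ.
Qed.

Lemma count_lt (I : eqType) (a b : pred I) (s : seq I) x :
    {in s, subpred a b} -> x \in s -> b x -> ~~ a x -> count a s < count b s.
Proof.
move=> sub xs bx nax; rewrite -(size_filter b) -(count_predC a) !count_filter -addn1.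
apply: leq_add; last by rewrite -has_count; apply/hasP; exists x; rewrite //= nax.
by apply/eq_leq/eq_in_count => y ys /=; case ay: (a y) => //; rewrite (sub y ys ay).
Qed.

(* [Z'] stands for [Z :|: X] or [Z :\: X]. *)
Lemma count_crosses_lt T Z Z' X :
    separated T -> X \in node_sets T -> crosses Z X ->
    Z' :\: X = Z :\: X -> ~~ crosses Z' X ->
  count (crosses Z') (node_sets T) < count (crosses Z) (node_sets T).
Proof.
move=> sepT XT cX eqZ ncX; apply: (count_lt _ XT cX ncX) => Y YT cY.
case/or3P: (node_sets_laminar sepT XT YT) => [sXY|sYX|dXY].
- exact: crosses_sub cX.
- by rewrite (crosses_sub sYX cY) in ncX.
- by rewrite -(crosses_disjoint dXY eqZ).
Qed.

Fixpoint graft Z p T W : dtree V :=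
  match p, T with
  | b :: p', Node l r =>
      if b then Node (trim (~: Z) l) (graft Z p' r W)
      else Node (graft Z p' l W) (trim (~: Z) r)
  | _, _ => W
  end.

Variable lam : {set V} -> nat.
Local Notation label T := (lam (vertices T)).

Fixpoint path_to s p T U : Prop :=
  match p, T with
  | [::], _ => T = U /\ s <= label U
  | b :: p', Node l r => s <= label T /\ path_to s p' (if b then r else l) U
  | _, _ => False
  end.

Lemma path_to_sub s p T U : path_to s p T U -> vertices U \subset vertices T.
Proof.
elim: p T => [|b p IH] [A|l r] //= []; try by move=> <-.
move=> _ /IH; case: b => sub; apply: subset_trans sub _; first exact: subsetUr.
exact: subsetUl.
Qed.

Lemma path_to_rcons s p T l r b : path_to s p T (Node l r) ->
  s <= label (if b then r else l) -> path_to s (rcons p b) T (if b then r else l).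
Proof.
elim: p T => [|c p IH] [A|l' r'] //=; first by case.
  by case=> [[-> ->]].
by case=> -> /IH pathU /pathU.
Qed.

Lemma path_to_size s p T U : path_to s p T U -> tree_size U + size p <= tree_size T.
Proof.
elim: p T => [|b p IH] [A|l r] //=; try by case=> <- _; rewrite addn0.
by case=> _ /IH; case: b; lia.
Qed.

Section Graft.
Variables (s : nat) (U W : dtree V) (Z : {set V}).
Hypotheses (sUZ : vertices U \subset Z) (verticesW : vertices W = Z).

Lemma vertices_graft p T : path_to s p T U ->
  vertices (graft Z p T W) = vertices T :|: Z.
Proof.
elim: p T => [|b p IH] T; first by case=> -> _; rewrite verticesW; apply/esym/setUidPr.
by case: T => //= l r [_]; case: b => /IH /= ->; rewrite vertices_trim;
  apply/setP=> i; rewrite !inE; case: (i \in Z); rewrite ?orbT ?orbF ?andbT ?andbF.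
Qed.

Lemma separated_graft p T : path_to s p T U -> separated T -> separated W ->
  separated (graft Z p T W).
Proof.
elim: p T => [|b p IH] [A|l r] //= [_ pathU] /and3P[dlr sepl sepr] sepW.
have disjZ X Y : [disjoint X & Y] -> [disjoint X :&: ~: Z & Y :|: Z].
  move=> dXY; rewrite disjoints_subset setCU subsetI subsetIr andbT.
  by apply: subset_trans (subsetIl _ _) _; rewrite -disjoints_subset.
case: b pathU => pathU /=; rewrite separated_trim // IH //.
  by rewrite (vertices_graft pathU) vertices_trim disjZ.
by rewrite (vertices_graft pathU) vertices_trim disjoint_sym disjZ // disjoint_sym.
Qed.

End Graft.
End DecompositionTrees.

(** * Uncrossing and linked trees *)

Section CopyLabels.
Variables (V : finType) (lam : {set V} -> nat).
Implicit Types (T U W : dtree V) (X Y Z : {set V}) (p : seq bool) (t : nat * nat * nat).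
Local Notation label T := (lam (vertices T)).

(* [reach j T] counts the descendants joined to the root by labels at least [j]
   and [pairs j T] the pairs joined in this way; uncrossing separates the two ends
   of an unlinked pair and decreases [pairs]. *)
Fixpoint reach j T : nat :=
  if j <= label T then (if T is Node l r then reach j l + reach j r else 0).+1 else 0.

Fixpoint pairs j T : nat :=
  reach j T + if T is Node l r then pairs j l + pairs j r else 0.

Lemma pairs_Node j l r :
  pairs j (Node l r) = reach j (Node l r) + (pairs j l + pairs j r).
Proof. by []. Qed.

Lemma reach0 j T : label T < j -> reach j T = 0.
Proof. by case: T => [A|l r] /= ltj; rewrite leqNgt ltj. Qed.

Definition width_le k T : bool := all (fun X => lam X <= k) (node_sets T).

Lemma width_leE k T : width_le k T =
  (label T <= k) && (if T is Node l r then width_le k l && width_le k r else true).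
Proof. by case: T => [A|l r]; rewrite /width_le /= ?all_cat. Qed.

(* Uncrossing along [Z] turns [T] into [trim Z T] together with the rest of [T],
   where [Z] is either removed from the node sets or, along the path, added to
   them: each node set gets two copies. *)
Definition copy_labels Z (on_path : bool) X : nat * nat * nat :=
  (lam X, lam (X :&: Z), lam (if on_path then X :|: Z else X :\: Z)).

Definition off_labels Z T := [seq copy_labels Z false X | X <- node_sets T].

Fixpoint path_labels Z p T : seq (nat * nat * nat) :=
  match p, T with
  | b :: p', Node l r => copy_labels Z true (vertices T) ::
      off_labels Z (if b then l else r) ++ path_labels Z p' (if b then r else l)
  | _, _ => [::]
  end.

Lemma path_labelsP s p T U Z t : separated T -> path_to lam s p T U ->
    t \in path_labels Z p T ->
  exists2 X, X \in node_sets T &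
    [disjoint X & vertices U] /\ t = copy_labels Z false X \/
    vertices U \subset X /\ t = copy_labels Z true X.
Proof.
elim: p T => [|b p IH] [A|l r] // sepT pathU; have sUT := path_to_sub pathU.
case: pathU sepT => _ pathU /and3P[dlr sepl sepr]; rewrite in_cons => /predU1P[->|].
  by exists (vertices (Node l r)); [exact: mem_head|right].
have [sepb dU subT] : [/\ separated (if b then r else l),
    [disjoint vertices (if b then l else r) & vertices U] &
    {subset node_sets (if b then l else r) <= node_sets (Node l r)} /\
    {subset node_sets (if b then r else l) <= node_sets (Node l r)}].
  have sub := path_to_sub pathU; split; first by case: (b).
    by case: (b) sub => sub; apply: disjointWr sub _; rewrite // disjoint_sym.
  by case: (b); split=> X Xlr; rewrite /= in_cons mem_cat Xlr !orbT.
case: subT => sub_sib sub_child; rewrite mem_cat => /orP[/mapP[X Xsib ->]|].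
  exists X; [exact: sub_sib|left; split=> //].
  exact: disjointWl (node_set_sub Xsib) dU.
by case/(IH _ sepb pathU) => X Xchild labX; exists X; first exact: sub_child.
Qed.

Definition at_most_one_copy j t : bool :=
  [&& (j <= t.1.2) ==> (j <= t.1.1), (j <= t.2) ==> (j <= t.1.1) &
      ~~ ((j <= t.1.2) && (j <= t.2))].

Definition no_copy j t : bool := [&& j <= t.1.1, t.1.2 < j & t.2 < j].

Lemma copies_le j t i i1 i2 : at_most_one_copy j t -> i1 <= i -> i2 <= i -> 0 < i ->
  (if j <= t.1.2 then i1 else 0) + (if j <= t.2 then i2 else 0) + no_copy j t
    <= (if j <= t.1.1 then i else 0).
Proof.
rewrite /at_most_one_copy /no_copy; case: t => [[a b] c] /=.
by case: (leqP j a) => ?; case: (leqP j b) => ?; case: (leqP j c) => ? //=; lia.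
Qed.

Lemma reach_trim j Z T : all (at_most_one_copy j) (off_labels Z T) ->
  reach j (trim Z T) + reach j (trim (~: Z) T) +
    no_copy j (copy_labels Z false (vertices T)) <= reach j T.
Proof.
elim: T => [A|l IHl r IHr]; rewrite /off_labels [node_sets _]/= [all _ _]/=.
  by rewrite andbT => one; rewrite /= -setDE; exact: (copies_le one).
rewrite map_cat all_cat => /and3P[one /IHl le_l /IHr le_r].
rewrite /= !vertices_trim -!setIUl -setDE; apply: (copies_le one) => //; lia.
Qed.

Lemma pairs_trim j Z T : all (at_most_one_copy j) (off_labels Z T) ->
  pairs j (trim Z T) + pairs j (trim (~: Z) T) + count (no_copy j) (off_labels Z T)
    <= pairs j T.
Proof.
elim: T => [A|l IHl r IHr] one; have := reach_trim one.
  by rewrite /off_labels [node_sets _]/= [count _ _]/= /=; lia.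
move: one; rewrite /off_labels [node_sets _]/= [all _ _]/= [count _ _]/=.
rewrite map_cat all_cat count_cat => /and3P[_ /IHl le_l /IHr le_r].
rewrite [trim Z _]/= [trim (~: Z) _]/= !pairs_Node.
by move: le_l le_r; rewrite /off_labels /=; lia.
Qed.

Section Graft.
Variables (s j : nat) (U W : dtree V) (Z : {set V}).
Hypotheses (sUZ : vertices U \subset Z) (verticesW : vertices W = Z) (ltZ : lam Z < j).

Lemma reach_graft p T :
    path_to lam s p T U -> all (at_most_one_copy j) (path_labels Z p T) ->
  reach j (trim Z T) + reach j (graft Z p T W) + (if p is [::] then 0 else
    no_copy j (copy_labels Z true (vertices T)) : nat) <= reach j T.
Proof.
elim: p T => [|b p IH] T.
  by case=> -> _ _; rewrite (reach0 (T := W)) ?verticesW // trim_id ?addn0.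
case: T => // l r pathU; have := vertices_graft sUZ verticesW pathU.
case: pathU => _ pathU.
rewrite [path_labels _ _ _]/= [all _ _]/= all_cat => verticesG.
case/and3P=> one /reach_trim le_sib /(IH _ pathU) le_child.
case: b pathU verticesG one le_sib le_child => _ /= -> one le_sib le_child;
  rewrite !vertices_trim -setIUl; apply: (copies_le one) => //; lia.
Qed.

Lemma pairs_graft p T :
    path_to lam s p T U -> all (at_most_one_copy j) (path_labels Z p T) ->
  pairs j (trim Z T) + pairs j (graft Z p T W) + count (no_copy j) (path_labels Z p T)
    <= pairs j T + pairs j W.
Proof.
elim: p T => [|b p IH] T; first by case=> -> _ _; rewrite trim_id ?addn0.
case: T => // l r pathU one; have := reach_graft pathU one; case: pathU one => _ pathU.
rewrite [path_labels _ _ _]/= [all _ _]/= [count _ _]/= all_cat count_cat.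
case/and3P=> _ /pairs_trim le_sib /(IH _ pathU) le_child.
rewrite [trim Z (Node l r)]/= [graft Z (_ :: _) _ _]/= [vertices (Node l r)]/=.
by case: b pathU le_sib le_child => _ le_sib le_child; rewrite !pairs_Node; lia.
Qed.

End Graft.

(* When the label of [Z] is below the label [s] of the path itself, the count drops
   strictly, as the graft cuts the path. *)
Section GraftBelowPath.
Variables (s : nat) (U W : dtree V) (Z : {set V}).
Hypotheses (sUZ : vertices U \subset Z) (verticesW : vertices W = Z) (ltZ : lam Z < s).

Lemma reach_graft_lt p T :
    path_to lam s p T U -> all (at_most_one_copy s) (path_labels Z p T) ->
  reach s (graft Z p T W) < reach s T.
Proof.
elim: p T => [|b p IH] T.
  by case=> -> + _; rewrite (reach0 (T := W)) ?verticesW //; case: (U) => [A|l r] /= ->.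
case: T => // l r [leT pathU]; rewrite [reach s (Node l r)]/= leT ltnS.
rewrite [path_labels _ _ _]/= [all _ _]/= all_cat.
case/and3P=> _ /reach_trim le_sib /(IH _ pathU) lt_child.
by case: b pathU le_sib lt_child => _ le_sib lt_child /=; case: ifP => // _; lia.
Qed.

Lemma pairs_graft_lt b p T : path_to lam s (b :: p) T U -> lam (vertices T :&: Z) < s ->
    all (at_most_one_copy s) (path_labels Z (b :: p) T) ->
  pairs s (trim Z T) + pairs s (graft Z (b :: p) T W) < pairs s T + pairs s W.
Proof.
case: T => // l r pathU ltTZ one; have := reach_graft_lt pathU one.
have : reach s (trim Z (Node l r)) = 0 by rewrite reach0 // vertices_trim.
case: pathU one => _ pathU; rewrite [path_labels _ _ _]/= [all _ _]/= all_cat.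
case/and3P=> _ /pairs_trim le_sib one.
have := pairs_graft sUZ verticesW ltZ pathU one.
rewrite [trim Z (Node l r)]/= [graft Z (_ :: _) _ _]/=.
by case: b pathU one le_sib => _ _ le_sib; rewrite !pairs_Node; lia.
Qed.

End GraftBelowPath.

Lemma width_trim k Z T : all (fun t => t.1.2 <= k) (off_labels Z T) ->
  width_le k (trim Z T).
Proof. by rewrite /width_le /off_labels node_sets_trim !all_map. Qed.

Lemma width_trimC k Z T : all (fun t => t.2 <= k) (off_labels Z T) ->
  width_le k (trim (~: Z) T).
Proof.
rewrite /width_le node_sets_trim /off_labels !all_map.
by apply: sub_all => X /=; rewrite setDE.
Qed.

Lemma width_trim_path s k p T U Z : path_to lam s p T U -> vertices U \subset Z ->
    width_le k T -> all (fun t => t.1.2 <= k) (path_labels Z p T) ->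
  width_le k (trim Z T).
Proof.
move=> + sUZ; elim: p T => [|b p IH] T; first by case=> -> _; rewrite trim_id.
case: T => // l r [_ pathU].
rewrite [width_le k (Node l r)]width_leE => /and3P[_ wl wr].
rewrite [path_labels _ _ _]/= [all _ _]/= all_cat width_leE vertices_trim.
case/and3P=> /= -> /width_trim w_sib /(IH _ pathU) w_child.
by case: b pathU w_sib w_child => _ -> ->.
Qed.

Lemma width_graft s k p T U W Z : path_to lam s p T U -> vertices U \subset Z ->
    vertices W = Z -> width_le k W -> all (fun t => t.2 <= k) (path_labels Z p T) ->
  width_le k (graft Z p T W).
Proof.
move=> + sUZ verticesW wW; elim: p T => [|b p IH] [A|l r] // pathU.
have := vertices_graft sUZ verticesW pathU; case: pathU => _ pathU verticesG.
rewrite width_leE verticesG [path_labels _ _ _]/= [all _ _]/= all_cat.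
case/and3P=> /= -> /width_trimC w_sib /(IH _ pathU) w_child.
by case: b pathU {verticesG} w_sib w_child => _ -> ->.
Qed.

End CopyLabels.

Section LinkedTrees.
Variables (V : finType) (lam : {set V} -> nat).
Implicit Types (T U : dtree V) (X Y Z : {set V}) (p : seq bool) (t : nat * nat * nat).
Local Notation label T := (lam (vertices T)).
Local Notation path_to := (path_to lam).
Local Notation reach := (reach lam).
Local Notation pairs := (pairs lam).
Local Notation width_le := (width_le lam).
Local Notation path_labels := (path_labels lam).
Local Notation copy_labels := (copy_labels lam).

Definition rearrangement k T T' : Prop :=
  [/\ vertices T' = vertices T, separated T' & width_le k T'].

Definition no_worse j T T' : Prop :=
  forall i, j <= i -> reach i T' <= reach i T /\ pairs i T' <= pairs i T.

Definition improves k T T' : Prop :=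
  rearrangement k T T' /\ exists2 j, j <= k & pairs j T' < pairs j T /\ no_worse j T T'.

Lemma rearrangement_Node k l r l' r' : separated (Node l r) -> width_le k (Node l r) ->
  rearrangement k l l' -> rearrangement k r r' ->
  rearrangement k (Node l r) (Node l' r').
Proof.
move=> /and3P[dlr _ _] + [eql sepl wl] [eqr sepr wr].
rewrite width_leE => /andP[lab _]; split=> /=; rewrite ?eql ?eqr //; first exact/and3P.
by rewrite width_leE /= eql eqr lab wl.
Qed.

Lemma no_worse_Node j l r l' r' :
    vertices l' = vertices l -> vertices r' = vertices r ->
  no_worse j l l' -> no_worse j r r' -> no_worse j (Node l r) (Node l' r').
Proof.
move=> eql eqr nwl nwr i ji; have [? ?] := nwl i ji; have [? ?] := nwr i ji.
by rewrite !pairs_Node /= eql eqr; case: ifP => _; lia.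
Qed.

Lemma improves_Nodel k l r l' : separated (Node l r) -> width_le k (Node l r) ->
  improves k l l' -> improves k (Node l r) (Node l' r).
Proof.
move=> sepT widthT [rearr_l [j jk [lt_l nw_l]]].
have [sepr wr] : separated r /\ width_le k r.
  by move: sepT widthT => /= /and3P[_ _ ->]; rewrite width_leE => /and3P[].
split; first exact: rearrangement_Node.
have nwT : no_worse j (Node l r) (Node l' r).
  by case: rearr_l => eql _ _; exact: no_worse_Node.
exists j => //; split=> //; have [le_reach _] := nwT j (leqnn j).
by rewrite !pairs_Node; lia.
Qed.

Lemma improves_Noder k l r r' : separated (Node l r) -> width_le k (Node l r) ->
  improves k r r' -> improves k (Node l r) (Node l r').
Proof.
move=> sepT widthT [rearr_r [j jk [lt_r nw_r]]].
have [sepl wl] : separated l /\ width_le k l.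
  by move: sepT widthT => /= /and3P[_ -> _]; rewrite width_leE => /and3P[].
split; first exact: rearrangement_Node.
have nwT : no_worse j (Node l r) (Node l r').
  by case: rearr_r => eqr _ _; exact: no_worse_Node.
exists j => //; split=> //; have [le_reach _] := nwT j (leqnn j).
by rewrite !pairs_Node; lia.
Qed.

Lemma exists_unimprovable k T : separated T -> width_le k T ->
  exists2 T', rearrangement k T T' & forall T'', ~ improves k T' T''.
Proof.
move=> sepT widthT.
have [|T' rearrT' minT'] :=
    @exists_lex_minimal _ (rearrangement k T) (fun i => pairs (k - i)) k.+1.
  by exists T.
exists T' => // T'' [[eqv sep'' width''] [j jk [lt_j nw]]].
move: lt_j; rewrite ltnNge -(subKn jk) => /negP; apply.
apply: (minT' T'' (k - j)) => [||i ij]; last by have [] := nw (k - i); first lia.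
  by case: rearrT' => eqv' _ _; split; rewrite // eqv.
by rewrite ltnS leq_subr.
Qed.

Definition uncrossed z t : bool :=
  [|| (t.1.2 < t.1.1) && (t.2 < t.1.1), (t.1.2 == t.1.1) && (t.2 <= z) |
      (t.2 == t.1.1) && (t.1.2 <= z)].

Lemma uncrossed_at_most_one_copy z j ts : all (uncrossed z) ts -> z < j ->
    (forall i, j < i -> ~~ has (no_copy i) ts) ->
  all (at_most_one_copy j) ts.
Proof.
move=> /allP unc zj none_lost; apply/allP=> -[[a b] c] t_ts; have := unc _ t_ts.
have : a <= j \/ ~~ no_copy a (a, b, c).
  by have [le|/none_lost/hasPn none] := leqP a j; [left|right; exact: none].
by rewrite /uncrossed /no_copy /at_most_one_copy /= leqnn; lia.
Qed.

Section Uncrossing.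
Variables (k : nat) (T U : dtree V) (b : bool) (p : seq bool) (Z : {set V}).
Hypotheses (sepT : separated T) (widthT : width_le k T).
Hypotheses (pathU : path_to (label T) (b :: p) T U).
Hypotheses (sUZ : vertices U \subset Z) (sZT : Z \subset vertices T).
Hypotheses (ltZ : lam Z < label T).
Hypothesis uncrossedZ : all (uncrossed (lam Z)) (path_labels Z (b :: p) T).

Local Notation ts := (path_labels Z (b :: p) T).
Local Notation T' := (graft Z (b :: p) T (trim Z T)).

Let verticesW : vertices (trim Z T) = Z.
Proof. by rewrite vertices_trim; apply/setIidPr. Qed.

Let label_le t : t \in ts -> [/\ t.1.1 <= k, t.1.2 <= k & t.2 <= k].
Proof.
move=> t_ts; have unc := allP uncrossedZ _ t_ts.
have orig_le : t.1.1 <= k.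
  by have [X XT [[_ ->]|[_ ->]]] := path_labelsP sepT pathU t_ts; exact: (allP widthT).
have label_T : label T <= k by move: widthT; rewrite width_leE => /andP[].
case: t unc orig_le {t_ts} => [[a a1] a2]; rewrite /uncrossed /=.
by move: ltZ label_T => ? ? ? ?; split; lia.
Qed.

Lemma graft_rearrangement : rearrangement k T T'.
Proof.
split.
- by rewrite (vertices_graft sUZ verticesW pathU); apply/setUidPl.
- by apply: (separated_graft sUZ verticesW pathU) => //; exact: separated_trim.
- apply: (width_graft pathU) => //; last by apply/allP=> t /label_le[].
  by apply: (width_trim_path pathU) => //; apply/allP=> t /label_le[].
Qed.

Definition none_lost_above j : Prop := forall i, j < i -> ~~ has (no_copy i) ts.

Lemma one_copy_of_none_lost j : label T <= j -> none_lost_above j ->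
  all (at_most_one_copy j) ts.
Proof.
by move=> sj; apply: uncrossed_at_most_one_copy uncrossedZ _; exact: leq_trans sj.
Qed.

Lemma graft_le j : label T <= j -> none_lost_above j ->
  reach j T' <= reach j T /\ pairs j T' + count (no_copy j) ts <= pairs j T.
Proof.
move=> sj none; have ltZj := leq_trans ltZ sj.
have one := one_copy_of_none_lost sj none.
have := reach_graft sUZ verticesW ltZj pathU one.
by have := pairs_graft sUZ verticesW ltZj pathU one; lia.
Qed.

Lemma graft_no_worse j : label T <= j -> none_lost_above j -> no_worse j T T'.
Proof.
move=> sj none i ji; have [||le_reach le_pairs] := @graft_le i; last by split; lia.
  exact: leq_trans ji.
by move=> i' ii'; apply: none; exact: leq_ltn_trans ii'.
Qed.

(* Some pairs are separated at the highest level at which a node loses both copies,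
   and at the level of the path if there is no such node. *)
Lemma graft_improves : improves k T T'.
Proof.
split; first exact: graft_rearrangement.
have label_T : label T <= k by move: widthT; rewrite width_leE => /andP[].
pose lost i := (label T < i) && has (no_copy i) ts.
have lost_le i : lost i -> i <= k.
  case/andP=> _ /hasP[t /label_le[le_tk _ _] /and3P[le_it _ _]]; exact: leq_trans le_tk.
have [[i lost_i]|never_lost] := pselect (exists i, lost i).
  case: (ex_maxnP (ex_intro _ i lost_i) lost_le) => j lost_j max_j.
  have /andP[/ltnW sj has_j] := lost_j.
  have none : none_lost_above j.
    move=> i' ji'; apply/negP=> has_i'; move: (ji').
    by rewrite ltnNge max_j // /lost has_i' (leq_ltn_trans sj ji').
  exists j; first exact: lost_le.
  split; last exact: graft_no_worse.
  by have [_] := graft_le sj none; move: has_j; rewrite has_count; lia.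
have none : none_lost_above (label T).
  by move=> i si; apply/negP=> has_i; apply: never_lost; exists i; rewrite /lost si.
exists (label T) => //; split; last exact: graft_no_worse.
have ltTZ : lam (vertices T :&: Z) < label T by rewrite (setIidPr sZT).
have one := one_copy_of_none_lost (leqnn _) none.
by have := pairs_graft_lt sUZ verticesW ltZ pathU ltTZ one; lia.
Qed.

End Uncrossing.

Hypothesis lamC : forall X, lam (~: X) = lam X.
Hypothesis lam_submod : forall X Y, lam (X :&: Y) + lam (X :|: Y) <= lam X + lam Y.
Hypothesis lam0 : lam set0 = 0.

Section MinimalCut.
Variables (T U : dtree V) (Z X : {set V}).
Hypotheses (sepT : separated T) (XT : X \in node_sets T).
Hypotheses (sUZ : vertices U \subset Z) (sZT : Z \subset vertices T).
Hypothesis min_label : forall Z', vertices U \subset Z' -> Z' \subset vertices T ->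
  lam Z <= lam Z'.
Hypothesis min_crosses : forall Z', vertices U \subset Z' -> Z' \subset vertices T ->
  count (crosses Z') (node_sets T) < count (crosses Z) (node_sets T) -> lam Z < lam Z'.

Let sXT : X \subset vertices T. Proof. exact: node_set_sub. Qed.

Lemma uncrossed_off_path : [disjoint X & vertices U] ->
  uncrossed (lam Z) (copy_labels Z false X).
Proof.
move=> dXU; rewrite /uncrossed /=; have [cX|] := boolP (crosses Z X); last first.
  rewrite negb_and !negbK setI_eq0 setD_eq0 => /orP[dXZ|sXZ].
    by rewrite (setDidPl dXZ) (disjoint_setI0 dXZ) lam0 eqxx !orbT.
  have /eqP XDZ0 : X :\: Z == set0 by rewrite setD_eq0.
  by rewrite (setIidPl sXZ) XDZ0 lam0 eqxx !orbT.
have ltU : lam Z < lam (Z :|: X).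
  apply: min_crosses; rewrite ?subUset ?sZT ?(subset_trans sUZ) ?subsetUl //.
  apply: (count_crosses_lt sepT XT cX); first by rewrite setDUl setDv setU0.
  by rewrite /crosses setDUr setDv setI0 eqxx andbF.
have ltD : lam Z < lam (Z :\: X).
  apply: min_crosses; rewrite ?subsetD ?sUZ 1?disjoint_sym //.
    exact: subset_trans (subsetDl _ _) sZT.
  apply: (count_crosses_lt sepT XT cX); first by rewrite setDDl setUid.
  by rewrite /crosses setIDA setIC -setIDA setDv setI0 eqxx.
have := lam_submod X Z; have := lam_submod X (~: Z).
rewrite -setDE [X :|: ~: Z]setUC -(lamC (~: Z :|: X)) setCU setCK -setDE (lamC Z).
rewrite [X :|: Z]setUC => leD leU; apply/orP; left; apply/andP; split.
  by move: leU ltU; clear; lia.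
by move: leD ltD; clear; lia.
Qed.

Lemma uncrossed_on_path : vertices U \subset X ->
  uncrossed (lam Z) (copy_labels Z true X).
Proof.
move=> sUX; rewrite /uncrossed /=.
have leI : lam Z <= lam (X :&: Z).
  by apply: min_label; rewrite ?subsetI ?sUX // (subset_trans (subsetIl _ _) sXT).
have leU : lam Z <= lam (X :|: Z).
  by apply: min_label; rewrite ?subUset ?sXT // (subset_trans sUX (subsetUl _ _)).
by move: (lam_submod X Z) leI leU; clear; lia.
Qed.

End MinimalCut.

Lemma exists_uncrossed_cut s p T U Z0 : separated T -> path_to s p T U ->
    vertices U \subset Z0 -> Z0 \subset vertices T ->
  exists Z, [/\ vertices U \subset Z, Z \subset vertices T, lam Z <= lam Z0 &
    all (uncrossed (lam Z)) (path_labels Z p T)].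
Proof.
move=> sepT pathU sUZ0 sZ0T.
pose between Z := vertices U \subset Z /\ Z \subset vertices T.
pose measure i Z := if i is 0 then lam Z else count (crosses Z) (node_sets T).
have [|Z [sUZ sZT] minZ] := @exists_lex_minimal _ between measure 2; first by exists Z0.
have min_label Z' : vertices U \subset Z' -> Z' \subset vertices T -> lam Z <= lam Z'.
  by move=> sUZ' sZ'T; exact: (minZ Z' 0).
have min_crosses Z' : vertices U \subset Z' -> Z' \subset vertices T ->
    count (crosses Z') (node_sets T) < count (crosses Z) (node_sets T) ->
    lam Z < lam Z'.
  move=> sUZ' sZ'T; apply: contraTltn => le_lam; rewrite -leqNgt.
  by apply: (minZ Z' 1) => // -[|i].
exists Z; split=> //; first exact: min_label.
apply/allP=> t /(path_labelsP sepT pathU)[X XT [[dXU ->]|[sUX ->]]].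
  exact: (uncrossed_off_path sepT XT sUZ).
exact: (uncrossed_on_path XT sUZ).
Qed.

Definition root_linked T : Prop := forall p U, path_to (label T) p T U ->
  forall Z, vertices U \subset Z -> Z \subset vertices T -> label T <= lam Z.

Fixpoint linked T : Prop :=
  root_linked T /\ if T is Node l r then linked l /\ linked r else True.

Lemma unimprovable_root_linked k T : separated T -> width_le k T ->
  (forall T', ~ improves k T T') -> root_linked T.
Proof.
move=> sepT widthT unimp p U pathU Z0 sUZ0 sZ0T; rewrite leqNgt; apply/negP=> ltZ0.
have [Z [sUZ sZT leZ uncZ]] := exists_uncrossed_cut sepT pathU sUZ0 sZ0T.
have ltZ := leq_ltn_trans leZ ltZ0.
case: p pathU uncZ => [[eqTU _] _|b p pathU uncZ]; last first.
  exact: (unimp _ (graft_improves sepT widthT pathU sUZ sZT ltZ uncZ)).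
have eqZ : Z = vertices T by apply/eqP; rewrite eqEsubset sZT eqTU sUZ.
by rewrite eqZ ltnn in ltZ.
Qed.

Lemma unimprovable_linked k T : separated T -> width_le k T ->
  (forall T', ~ improves k T T') -> linked T.
Proof.
elim: T => [A|l IHl r IHr] sepT widthT unimp; split=> //;
  try exact: unimprovable_root_linked unimp.
have /and3P[_ sepl sepr] := sepT.
have /and3P[_ wl wr] : _ && _ := etrans (esym (width_leE _ _ _)) widthT.
split; [apply: IHl|apply: IHr] => // T' imp.
  exact: unimp (improves_Nodel sepT widthT imp).
exact: unimp (improves_Noder sepT widthT imp).
Qed.

Theorem exists_linked_rearrangement k T : separated T -> width_le k T ->
  exists2 T', rearrangement k T T' & linked T'.
Proof.
move=> sepT widthT; have [T' rearrT' unimp] := exists_unimprovable sepT widthT.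
by exists T' => //; case: rearrT' => _ sepT' widthT'; exact: unimprovable_linked unimp.
Qed.

End LinkedTrees.

(** * Minors of labelled relations *)

Section RelationMinor.
Variables (A : zmodType) (B : Type).
Local Open Scope ring_scope.

(* Off the image of [X], the indices in [S] are contracted ([y = 0]) and the others
   deleted ([x = 0]). *)
Definition extends n n' (f : 'I_n -> 'I_n') (S : {set 'I_n'}) (X : {set 'I_n})
    (X' : {set 'I_n'}) (x y : 'cV[A]_n) (x' y' : 'cV[A]_n') : Prop :=
  {in X, forall i, x' (f i) 0 = x i 0 /\ y' (f i) 0 = y i 0} /\
  {in X' :\: f @: X, forall j, (if j \in S then y' j 0 else x' j 0) = 0}.

Lemma extends_sub n n' f S X X' (x1 y1 x2 y2 : 'cV[A]_n) (x1' y1' x2' y2' : 'cV[A]_n') :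
    extends f S X X' x1 y1 x1' y1' -> extends f S X X' x2 y2 x2' y2' ->
  extends f S X X' (x1 - x2) (y1 - y2) (x1' - x2') (y1' - y2').
Proof.
move=> [eq1 zero1] [eq2 zero2]; split=> [i iX|j jX].
  have [ex1 ey1] := eq1 i iX; have [ex2 ey2] := eq2 i iX.
  by rewrite !mxE ex1 ey1 ex2 ey2.
have := zero1 j jX; have := zero2 j jX.
by rewrite !mxE; case: ifP => _ -> ->; rewrite subr0.
Qed.

Lemma eq_extends n n' f S (X : {set 'I_n}) (X' : {set 'I_n'}) (x y : 'cV[A]_n)
    (x1 y1 x2 y2 : 'cV[A]_n') :
    f @: X \subset X' -> {in X', forall j, x1 j 0 = x2 j 0 /\ y1 j 0 = y2 j 0} ->
  extends f S X X' x y x1 y1 -> extends f S X X' x y x2 y2.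
Proof.
move=> sfX eq12 [eqs zeros]; split=> [i iX|j jX].
  have [|<- <-] := eq12 (f i); last exact: eqs.
  by apply: (subsetP sfX); exact: imset_f.
by have [|<- <-] := eq12 j; [case/setDP: jX|exact: zeros].
Qed.

Definition comp_contracted n' n'' (g : 'I_n' -> 'I_n'') (X' S : {set 'I_n'})
    (S' : {set 'I_n''}) : {set 'I_n''} :=
  [set j | if j \in g @: X' then j \in g @: (S :&: X') else j \in S'].

Section Composition.
Variables (n n' n'' : nat) (f : 'I_n -> 'I_n') (g : 'I_n' -> 'I_n'').
Variables (X : {set 'I_n}) (X' S : {set 'I_n'}) (X'' S' : {set 'I_n''}).
Hypotheses (inj_g : {in X' &, injective g}) (sfX : f @: X \subset X').
Hypothesis sgX : g @: X' \subset X''.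

Let fX' i : i \in X -> f i \in X'.
Proof. by move=> iX; apply: (subsetP sfX); exact: imset_f. Qed.

Let mem_comp_contracted i : i \in X' -> (g i \in comp_contracted g X' S S') = (i \in S).
Proof.
move=> iX'; rewrite inE imset_f //.
apply/imsetP/idP => [[i' /setIP[i'S i'X'] /inj_g ->]|iS] //.
by exists i; rewrite // inE iS.
Qed.

Let comp_image i : i \in X' -> (g i \in (g \o f) @: X) = (i \in f @: X).
Proof.
move=> iX'; rewrite imset_comp; apply/imsetP/idP => [[i' i'fX /inj_g ->]|ifX] //.
  exact: (subsetP sfX).
by exists i.
Qed.

Lemma extends_comp (x y : 'cV[A]_n) (x' y' : 'cV[A]_n') (x'' y'' : 'cV[A]_n'') :
    extends f S X X' x y x' y' -> extends g S' X' X'' x' y' x'' y'' ->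
  extends (g \o f) (comp_contracted g X' S S') X X'' x y x'' y''.
Proof.
move=> [eqf zerof] [eqg zerog]; split=> [i iX /=|j].
  by have [-> ->] := eqg _ (fX' iX); exact: eqf.
rewrite inE => /andP[njX jX'']; have [/imsetP[i iX' eqj]|njX'] := boolP (j \in g @: X').
  move: njX; rewrite eqj comp_image // mem_comp_contracted // => nifX.
  by have [-> ->] := eqg _ iX'; apply: zerof; rewrite inE nifX.
by rewrite inE (negbTE njX'); apply: zerog; rewrite inE njX'.
Qed.

Lemma extends_decomp (x y : 'cV[A]_n) (x'' y'' : 'cV[A]_n'') :
    extends (g \o f) (comp_contracted g X' S S') X X'' x y x'' y'' ->
  exists x' y', extends f S X X' x y x' y' /\ extends g S' X' X'' x' y' x'' y''.
Proof.
move=> [eqgf zerogf]; exists (\col_i x'' (g i) 0), (\col_i y'' (g i) 0); split; split.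
- by move=> i iX; rewrite !mxE; exact: eqgf.
- move=> i; rewrite inE => /andP[nifX iX']; rewrite !mxE -mem_comp_contracted //.
  by apply: zerogf; rewrite inE comp_image // nifX (subsetP sgX) // imset_f.
- by move=> i _; rewrite !mxE.
- move=> j; rewrite inE => /andP[njX' jX'']; have := zerogf j.
  rewrite !inE (negbTE njX') jX'' andbT.
  by apply; apply: contra njX'; rewrite imset_comp; apply/subsetP/imsetS.
Qed.

End Composition.

Section Gluing.
Variables (n n' : nat) (X1 X2 : {set 'I_n}) (X1' X2' S1 S2 : {set 'I_n'}).
Variables f1 f2 : 'I_n -> 'I_n'.
Hypotheses (dX : [disjoint X1 & X2]) (dX' : [disjoint X1' & X2']).
Hypotheses (sfX1 : f1 @: X1 \subset X1') (sfX2 : f2 @: X2 \subset X2').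

Definition glue_fun i := if i \in X1 then f1 i else f2 i.
Definition glue_set := [set j | if j \in X1' then j \in S1 else j \in S2].

Let notX1 i : i \in X2 -> (i \in X1) = false. Proof. exact: disjointFl. Qed.
Let notX1' i : i \in X2' -> (i \in X1') = false. Proof. exact: disjointFl. Qed.

Let f1X i : i \in X1 -> f1 i \in X1'.
Proof. by move=> iX; apply: (subsetP sfX1); exact: imset_f. Qed.

Let f2X i : i \in X2 -> f2 i \in X2'.
Proof. by move=> iX; apply: (subsetP sfX2); exact: imset_f. Qed.

Let glue_fun1 : {in X1, glue_fun =1 f1}.
Proof. by move=> i iX; rewrite /glue_fun iX. Qed.

Let glue_fun2 : {in X2, glue_fun =1 f2}.
Proof. by move=> i iX; rewrite /glue_fun notX1. Qed.

Let imset_glue_fun : glue_fun @: (X1 :|: X2) = f1 @: X1 :|: f2 @: X2.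
Proof. by rewrite imsetU (eq_in_imset glue_fun1) (eq_in_imset glue_fun2). Qed.

Lemma glue_fun_inj : {in X1 &, injective f1} -> {in X2 &, injective f2} ->
  {in X1 :|: X2 &, injective glue_fun}.
Proof.
move=> inj1 inj2 i j /setUP[iX|iX] /setUP[jX|jX];
  rewrite ?(glue_fun1 iX) ?(glue_fun2 iX) ?(glue_fun1 jX) ?(glue_fun2 jX).
- exact: inj1.
- by move=> eq_ij; have := notX1' (f2X jX); rewrite -eq_ij f1X.
- by move=> eq_ij; have := notX1' (f2X iX); rewrite eq_ij f1X.
- exact: inj2.
Qed.

Lemma glue_fun_sub : glue_fun @: (X1 :|: X2) \subset X1' :|: X2'.
Proof. by rewrite imset_glue_fun setUSS. Qed.

Lemma extends_glue (x y : 'cV[A]_n) (x' y' : 'cV[A]_n') :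
  extends glue_fun glue_set (X1 :|: X2) (X1' :|: X2') x y x' y' <->
  extends f1 S1 X1 X1' x y x' y' /\ extends f2 S2 X2 X2' x y x' y'.
Proof.
have glue_set1 j : j \in X1' -> (j \in glue_set) = (j \in S1) by rewrite inE => ->.
have glue_set2 j : j \in X2' -> (j \in glue_set) = (j \in S2).
  by rewrite inE => /notX1' ->.
have removed : (X1' :|: X2') :\: glue_fun @: (X1 :|: X2) =
    (X1' :\: f1 @: X1) :|: (X2' :\: f2 @: X2).
  rewrite imset_glue_fun; apply/setP=> j; rewrite !inE negb_or.
  have not1 : j \in X1' -> j \notin f2 @: X2.
    by apply: contraL => /(subsetP sfX2)/notX1' ->.
  have not2 : j \in X2' -> j \notin f1 @: X1.
    by move=> /notX1' jX; apply: contraFN jX; exact: subsetP.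
  case: (boolP (j \in X1')) => jX1'.
    by rewrite (disjointFr dX' jX1') not1 // !andbT andbF orbF.
  by case: (boolP (j \in X2')) not2 => _ not2; rewrite ?andbF // not2 ?andbT.
split=> [[eqs zeros]|[[eqs1 zeros1] [eqs2 zeros2]]].
  split; split.
  - by move=> i iX; rewrite -glue_fun1 //; apply: eqs; rewrite inE iX.
  - move=> j jX; rewrite -glue_set1; first by apply: zeros; rewrite removed inE jX.
    by move: jX; rewrite inE => /andP[].
  - by move=> i iX; rewrite -glue_fun2 //; apply: eqs; rewrite inE iX orbT.
  - move=> j jX; rewrite -glue_set2; first by apply: zeros; rewrite removed inE jX orbT.
    by move: jX; rewrite inE => /andP[].
split=> [i /setUP[iX|iX]|j].
- by rewrite glue_fun1 //; exact: eqs1.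
- by rewrite glue_fun2 //; exact: eqs2.
rewrite removed => /setUP[jX|jX]; have /setDP[jX' _] := jX.
  by rewrite glue_set1 //; exact: zeros1.
by rewrite glue_set2 //; exact: zeros2.
Qed.

End Gluing.

Local Notation vrel n := ('cV[A]_n -> 'cV[A]_n -> B -> Prop).

Definition rel_minor n n' (R : vrel n) (R' : vrel n') (X : {set 'I_n})
    (X' : {set 'I_n'}) (phi : B -> B) : Prop :=
  exists f (S : {set 'I_n'}), [/\ {in X &, injective f}, f @: X \subset X' &
    forall x y c, R x y c <->
      exists x' y', R' x' y' (phi c) /\ extends f S X X' x y x' y'].

Lemma eq_rel_minor n n' (R1 R2 : vrel n) (R1' R2' : vrel n') (X : {set 'I_n})
    (X' : {set 'I_n'}) phi :
    (forall x y c, R2 x y c <-> R1 x y c) -> (forall x y c, R2' x y c <-> R1' x y c) ->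
  rel_minor R1 R1' X X' phi -> rel_minor R2 R2' X X' phi.
Proof.
move=> eqR eqR' [f [S [inj_f sfX relf]]].
exists f, S; split=> // x y c; rewrite eqR relf.
by split=> -[x' [y' [Rc ext]]]; exists x', y'; split=> //; apply/eqR'.
Qed.

Lemma rel_minor_trans n n' n'' (R : vrel n) (R' : vrel n') (R'' : vrel n'')
    X X' X'' phi phi' :
    rel_minor R R' X X' phi -> rel_minor R' R'' X' X'' phi' ->
  rel_minor R R'' X X'' (phi' \o phi).
Proof.
move=> [f [S [inj_f sfX relf]]] [g [S' [inj_g sgX relg]]].
exists (g \o f), (comp_contracted g X' S S'); split.
- move=> i j iX jX /= /inj_g eq_f; apply: inj_f => //.
  by apply: eq_f; apply: (subsetP sfX); exact: imset_f.
- by rewrite imset_comp (subset_trans (imsetS _ sfX)).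
move=> x y c; rewrite relf; split.
  case=> x' [y' [/relg[x'' [y'' [R''c extg]]] extf]].
  by exists x'', y''; split=> //; exact: extends_comp extf extg.
case=> x'' [y'' [R''c /(extends_decomp inj_g sfX sgX)[x' [y' [extf extg]]]]].
by exists x', y'; split=> //; apply/relg; exists x'', y''.
Qed.

Definition supported_on n (X : {set 'I_n}) (R : vrel n) : Prop :=
  forall (x y x' y' : 'cV[A]_n) c,
    {in X, forall i, x i 0 = x' i 0 /\ y i 0 = y' i 0} -> R x y c -> R x' y' c.

Definition glued n (G : B -> B -> B -> Prop) (R1 R2 : vrel n) : vrel n :=
  fun x y c => exists c1 c2, [/\ R1 x y c1, R2 x y c2 & G c c1 c2].

Lemma rel_minor_glue n n' (G : B -> B -> B -> Prop) (R1 R2 : vrel n) (R1' R2' : vrel n')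
    (X1 X2 : {set 'I_n}) (X1' X2' : {set 'I_n'}) :
    [disjoint X1 & X2] -> [disjoint X1' & X2'] ->
    supported_on X1' R1' -> supported_on X2' R2' ->
    rel_minor R1 R1' X1 X1' id -> rel_minor R2 R2' X2 X2' id ->
  rel_minor (glued G R1 R2) (glued G R1' R2') (X1 :|: X2) (X1' :|: X2') id.
Proof.
move=> dX dX' supp1 supp2 [f1 [S1 [inj1 sfX1 rel1]]] [f2 [S2 [inj2 sfX2 rel2]]].
exists (glue_fun X1 f1 f2), (glue_set X1' S1 S2); split.
- exact: (glue_fun_inj dX dX').
- exact: glue_fun_sub.
move=> x y c; split.
  case=> c1 [c2 [/rel1[x1 [y1 [R1c ext1]]] /rel2[x2 [y2 [R2c ext2]]] Gc]].
  pose x' := \col_j (if j \in X1' then x1 j 0 else x2 j 0).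
  pose y' := \col_j (if j \in X1' then y1 j 0 else y2 j 0).
  have at1 j : j \in X1' -> x1 j 0 = x' j 0 /\ y1 j 0 = y' j 0 by rewrite !mxE => ->.
  have at2 j : j \in X2' -> x2 j 0 = x' j 0 /\ y2 j 0 = y' j 0.
    by move=> jX2'; rewrite !mxE (disjointFl dX' jX2').
  exists x', y'; split; last first.
    apply/(extends_glue _ _ dX dX' sfX1 sfX2); split; first exact: eq_extends ext1.
    exact: eq_extends ext2.
  by exists c1, c2; split; [exact: supp1 at1 R1c|exact: supp2 at2 R2c|].
case=> x' [y' [[c1 [c2 [R1c R2c Gc]]] /(extends_glue _ _ dX dX' sfX1 sfX2)[ext1 ext2]]].
by exists c1, c2; split=> //; [apply/rel1|apply/rel2]; exists x', y'.
Qed.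

End RelationMinor.

(** * Chains and their boundaries *)

Section ChainGroup.
Variables (F : fieldType) (n : nat) (M : 'M[F]_n).
Local Open Scope ring_scope.
Implicit Types (X Y Z S : {set 'I_n}) (x y z w : 'cV[F]_n).

Definition restricted_chain X x y : Prop :=
  exists z, \I_X *m z = \I_X *m x /\ \I_X *m (M *m z) = \I_X *m y.

Definition supported_chain X x y : Prop := M *m (\I_X *m x) = \I_X *m y.

Lemma restricted_chainS X Y x y : X \subset Y ->
  restricted_chain Y x y -> restricted_chain X x y.
Proof.
move=> sXY [z [zx Mzy]]; exists z.
by rewrite -(indic_mxSl F sXY) -!(mulmxA \I_X) zx Mzy.
Qed.

Lemma restricted_chain_sub X x1 y1 x2 y2 : restricted_chain X x1 y1 ->
  restricted_chain X x2 y2 -> restricted_chain X (x1 - x2) (y1 - y2).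
Proof.
move=> [z1 [zx1 Mzy1]] [z2 [zx2 Mzy2]]; exists (z1 - z2).
by rewrite !mulmxBr zx1 zx2 Mzy1 Mzy2.
Qed.

Lemma restricted_chain_add_supported X x1 y1 x2 y2 : restricted_chain X x1 y1 ->
  supported_chain X (x2 - x1) (y2 - y1) -> restricted_chain X x2 y2.
Proof.
move=> [z [zx Mzy]] supp; exists (z + \I_X *m (x2 - x1)).
rewrite (mulmxDr M) supp !mulmxDr zx Mzy !mulmxA mul_indic_mx setIid -!mulmxDr.
by rewrite !subrKC.
Qed.

Lemma supported_chainU X1 X2 x y : [disjoint X1 & X2] ->
  supported_chain X1 x y -> supported_chain X2 x y -> supported_chain (X1 :|: X2) x y.
Proof.
by move=> dX s1 s2; rewrite /supported_chain indic_mxU // !mulmxDl mulmxDr s1 s2.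
Qed.

Definition cut_mx X : 'M[F]_n := \I_X *m M *m \I_(~: X).

Definition inflow X x y : 'cV[F]_n := \I_X *m y - \I_X *m (M *m (\I_X *m x)).
Definition outflow X x : 'cV[F]_n := \I_(~: X) *m (M *m (\I_X *m x)).

Lemma outflowE X x : outflow X x = cut_mx (~: X) *m x.
Proof. by rewrite /cut_mx setCK -!mulmxA. Qed.

Lemma inflow_cut_mx X x y : restricted_chain X x y ->
  exists w, inflow X x y = cut_mx X *m w.
Proof.
move=> [z [zx Mzy]]; exists z; rewrite /inflow -Mzy -zx -!mulmxA -!mulmxBr.
by congr (_ *m (_ *m _)); rewrite -{1}[z]mul1mx -(indic_mxC F X) mulmxDl addrC addKr.
Qed.

Lemma supported_chainP X x y :
  supported_chain X x y <-> inflow X x y = 0 /\ outflow X x = 0.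
Proof.
rewrite /inflow /outflow; split=> [->|[/eqP]].
  rewrite !mulmxA !mul_indic_mx setIid subrr.
  by rewrite setIC setICr indic_mx0 mul0mx.
rewrite subr_eq0 => /eqP eqX out0.
by rewrite /supported_chain -[LHS]mul1mx -(indic_mxC F X) mulmxDl -eqX out0 addr0.
Qed.

Section Boundary.
Variable k : nat.

Definition compress m p (A : 'M[F]_(m, p)) : 'M[F]_(k, m) :=
  pid_mx (\rank A) *m (row_base A *m pinvmx A).

Lemma mul_compress_eq0 m p q (A : 'M[F]_(m, p)) (B : 'M[F]_(p, q)) :
  (\rank A <= k)%N -> compress A *m (A *m B) = 0 -> A *m B = 0.
Proof.
move=> rkA; rewrite /compress -mulmxA (mulmxA _ A) mulmxKpV ?eq_row_base // => eq0.
have decB : row_base A *m B =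
    (pid_mx (\rank A) : 'M_(_, k)) *m (pid_mx (\rank A) *m (row_base A *m B)).
  by rewrite mulmxA pid_mx_id // pid_mx_1 mul1mx.
by rewrite -[A in LHS]mulmx_base -mulmxA decB eq0 !mulmx0.
Qed.

Definition boundary X x y : 'cV[F]_k * 'cV[F]_k :=
  (compress (cut_mx X) *m inflow X x y, compress (cut_mx (~: X)) *m outflow X x).

Definition boundary_rel X x y (c : 'cV[F]_k * 'cV[F]_k) : Prop :=
  restricted_chain X x y /\ boundary X x y = c.

Lemma boundary_rel_supported X : supported_on X (boundary_rel X).
Proof.
move=> x y x' y' c eqX.
have eqx : \I_X *m x = \I_X *m x' by apply/eq_mul_indic_mx=> i /eqX[].
have eqy : \I_X *m y = \I_X *m y' by apply/eq_mul_indic_mx=> i /eqX[].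
by rewrite /boundary_rel /restricted_chain /boundary /inflow /outflow eqx eqy.
Qed.

Lemma boundary_rel_setT x y c : boundary_rel setT x y c <-> y = M *m x /\ c = (0, 0).
Proof.
rewrite /boundary_rel /boundary /inflow /outflow /restricted_chain setCT.
rewrite indic_mx0 mul0mx mulmx0 indic_mxT !mul1mx.
split=> [[[z []]]|[-> ->]]; last first.
  by rewrite subrr mulmx0; split=> //; exists x; rewrite !mul1mx.
by rewrite !mul1mx => -> ->; rewrite subrr mulmx0 => <-.
Qed.

Definition small_cut X : bool := ((cutrank M X <= k) && (cutrank M (~: X) <= k))%N.

Lemma boundary_eqP X x1 y1 x2 y2 : small_cut X ->
    restricted_chain X x1 y1 -> restricted_chain X x2 y2 ->
  boundary X x1 y1 = boundary X x2 y2 <-> supported_chain X (x1 - x2) (y1 - y2).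
Proof.
move=> /andP[rkX rkCX] chain1 chain2.
have [w inw] := inflow_cut_mx (restricted_chain_sub chain1 chain2).
have eqin : inflow X (x1 - x2) (y1 - y2) = inflow X x1 y1 - inflow X x2 y2.
  by rewrite /inflow !mulmxBr !opprB addrACA [RHS]addrACA [X in _ + X]addrC.
have eqout : outflow X (x1 - x2) = outflow X x1 - outflow X x2.
  by rewrite /outflow !mulmxBr.
rewrite supported_chainP eqin eqout.
split=> [[eq1 eq2]|[/subr0_eq in12 /subr0_eq out12]].
  split.
    rewrite -eqin inw; apply: mul_compress_eq0 => //.
    by rewrite -inw eqin mulmxBr eq1 subrr.
  rewrite !outflowE -mulmxBr; apply: mul_compress_eq0 => //.
  by rewrite mulmxBr -!outflowE mulmxBr eq2 subrr.
by rewrite /boundary in12 out12.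
Qed.

Lemma boundary_relP X x y c x0 y0 : small_cut X -> boundary_rel X x0 y0 c ->
  boundary_rel X x y c <-> supported_chain X (x - x0) (y - y0).
Proof.
move=> smallX [chain0 <-]; split=> [[chain eqb]|supp]; first exact/boundary_eqP.
have chain := restricted_chain_add_supported chain0 supp.
by split=> //; apply/boundary_eqP.
Qed.

Definition glue_rel X1 X2 c c1 c2 : Prop := exists x y,
  [/\ boundary_rel (X1 :|: X2) x y c, boundary_rel X1 x y c1 & boundary_rel X2 x y c2].

Lemma boundary_rel_glued X1 X2 x y c : [disjoint X1 & X2] ->
    small_cut X1 -> small_cut X2 -> small_cut (X1 :|: X2) ->
  boundary_rel (X1 :|: X2) x y c <->
    glued (glue_rel X1 X2) (boundary_rel X1) (boundary_rel X2) x y c.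
Proof.
move=> dX small1 small2 smallU; split=> [Rc|].
  have restr Z : Z \subset X1 :|: X2 -> boundary_rel Z x y (boundary Z x y).
    by move=> sZ; split=> //; apply: restricted_chainS sZ _; case: Rc.
  have R1 := restr _ (subsetUl X1 X2); have R2 := restr _ (subsetUr X1 X2).
  by exists (boundary X1 x y), (boundary X2 x y); split=> //; exists x, y.
case=> c1 [c2 [R1c R2c [x0 [y0 [Rc0 R1c0 R2c0]]]]].
apply/(boundary_relP _ _ smallU Rc0)/supported_chainU => //.
  exact/(boundary_relP _ _ small1 R1c0).
exact/(boundary_relP _ _ small2 R2c0).
Qed.

End Boundary.
End ChainGroup.

Section LinkedCuts.
Variables (F : fieldType) (n : nat) (M : 'M[F]_n).
Local Open Scope ring_scope.
Implicit Types (A B C S X Y Z : {set 'I_n}) (x y z w : 'cV[F]_n).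

Lemma block_rank_saturated A B C S : C \subset A -> S \subset A -> [disjoint B & S] ->
    (block_rank M A B + #|S| <= block_rank M (C :|: S) (B :|: S))%N ->
  (\I_A *m M *m \I_B <= \I_(C :|: S) *m M *m \I_(B :|: S))%MS /\
  ((\I_S : 'M[F]_n) <= \I_(C :|: S) *m M *m \I_(B :|: S))%MS.
Proof.
move=> sCA sSA dBS saturated; set N := _ *m \I_(B :|: S).
have sub : (N <= \I_A *m M *m \I_B + (\I_S : 'M[F]_n))%MS.
  rewrite /N (indic_mxU F dBS) mulmxDr addmx_sub_adds ?submxMl //.
  have sCSA : C :|: S \subset A by rewrite subUset sCA.
  by rewrite -(indic_mxSl F sCSA) -!mulmxA submxMl.
apply/andP; rewrite -addsmx_sub -(mxrank_leqif_sup sub) eqn_leq mxrankS //=.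
apply: leq_trans saturated; apply: leq_trans (mxrank_adds_leqif _ _) _.
by rewrite rank_indic_mx.
Qed.

Variables (eps : F) (X Y : {set 'I_n}).
Hypotheses (eps0 : eps != 0) (symM : M^T = eps *: M).
Hypotheses (sXY : X \subset Y) (eqXY : cutrank M X = cutrank M Y).

Lemma exists_saturating_set :
    (forall Z, X \subset Z -> Z \subset Y -> (cutrank M Y <= cutrank M Z)%N) ->
  exists2 S : {set 'I_n}, S \subset Y :\: X &
    (cutrank M Y + #|S| <= block_rank M (X :|: S) (~: Y :|: S))%N.
Proof.
move=> linkXY; apply: exists_linking_set.
- exact: block_rankS.
- exact: block_rank_submod.
move=> Z sZ; have -> : ~: Y :|: (Y :\: X) :\: Z = ~: (X :|: Z).
  apply/setP=> i; have /implyP := subsetP sZ i; have /implyP := subsetP sXY i.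
  by rewrite !inE; case: (i \in X) (i \in Y) (i \in Z) => [] [] [].
apply: linkXY; first exact: subsetUl.
by rewrite subUset sXY (subset_trans sZ) ?subsetDl.
Qed.

Section SaturatingSet.
Variable S : {set 'I_n}.
Hypothesis sSYX : S \subset Y :\: X.
Hypothesis saturated : (cutrank M Y + #|S| <= block_rank M (X :|: S) (~: Y :|: S))%N.

Let sSY : S \subset Y. Proof. exact: subset_trans (subsetDl Y X). Qed.
Let dXS : [disjoint X & S].
Proof.
by rewrite disjoint_sym disjoints_subset; apply: subset_trans sSYX (subsetDr Y X).
Qed.

Let dYS : [disjoint ~: Y & S].
Proof. by rewrite disjoint_sym disjoints_subset setCK. Qed.

Local Notation N := (\I_(X :|: S) *m M *m \I_(~: Y :|: S)).
Local Notation N' := (\I_(~: Y :|: S) *m M *m \I_(X :|: S)).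

Lemma saturated_row_space :
  (\I_Y *m M *m \I_(~: Y) <= N)%MS /\ ((\I_S : 'M[F]_n) <= N)%MS.
Proof. exact: block_rank_saturated. Qed.

Lemma saturated_row_space_tr :
  (\I_(~: X) *m M *m \I_X <= N')%MS /\ ((\I_S : 'M[F]_n) <= N')%MS.
Proof.
apply: block_rank_saturated; rewrite ?setCS // -?disjoints_subset 1?disjoint_sym //.
rewrite (block_rank_tr X (~: X) eps0 symM) -/(cutrank M X) eqXY.
by rewrite (block_rank_tr (X :|: S) (~: Y :|: S) eps0 symM).
Qed.

Lemma saturated_kernel w : \I_(X :|: S) *m (M *m (\I_(~: Y :|: S) *m w)) = 0 ->
  \I_S *m w = 0 /\ \I_Y *m (M *m (\I_(~: Y) *m w)) = 0.
Proof.
rewrite !mulmxA => Nw0; have [/submxP[D ->] /submxP[D' ->]] := saturated_row_space.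
by rewrite -!(mulmxA _ N) Nw0 !mulmx0.
Qed.

Lemma saturated_kernel_tr w : \I_(~: Y :|: S) *m (M *m (\I_(X :|: S) *m w)) = 0 ->
  \I_S *m w = 0 /\ \I_(~: X) *m (M *m (\I_X *m w)) = 0.
Proof.
rewrite !mulmxA => N'w0; have [/submxP[D ->] /submxP[D' ->]] := saturated_row_space_tr.
by rewrite -!(mulmxA _ N') N'w0 !mulmx0.
Qed.

Lemma saturated_solvable u v : exists w,
  \I_(X :|: S) *m (M *m (\I_(~: Y :|: S) *m w)) =
    \I_X *m (M *m (\I_(~: X) *m u)) + \I_S *m v.
Proof.
have [/submxP[D /(congr1 trmx)] + /submxP[D' /(congr1 trmx)]] := saturated_row_space_tr.
rewrite (trmx_mul D) (trmx_mul D') !(tr_mul_indic_mx _ _ symM) tr_indic_mx -!scalemxAl.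
move=> /(scalerI eps0) eqX eqS.
exists (D^T *m u + eps *: (D'^T *m v)); rewrite !mulmxA eqX eqS.
by rewrite mulmxDr -scalemxAr -scalemxAl !mulmxA.
Qed.

Lemma extends_idP x y x' y' : extends id S X Y x y x' y' <->
  [/\ \I_X *m x' = \I_X *m x, \I_X *m y' = \I_X *m y, \I_S *m y' = 0 &
    \I_(Y :\: X :\: S) *m x' = 0].
Proof.
rewrite /extends imset_id; split=> [[eqs zeros]|].
  split; [apply/eq_mul_indic_mx=> i|apply/eq_mul_indic_mx=> i|
    apply/mul_indic_mx_eq0=> i iS|apply/mul_indic_mx_eq0=> i]; try by case/eqs.
    by have := zeros i (subsetP sSYX i iS); rewrite iS.
  by case/setDP=> iYX niS; have := zeros i iYX; rewrite (negbTE niS).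
case=> /eq_mul_indic_mx eqx /eq_mul_indic_mx eqy.
move=> /mul_indic_mx_eq0 zeroy /mul_indic_mx_eq0 zerox.
split=> [i iX|j jYX]; first by rewrite eqx // eqy.
by case: ifPn => [/zeroy //|njS]; apply: zerox; rewrite inE njS.
Qed.

Lemma linked_extension x y : restricted_chain M X x y ->
  exists x' y', restricted_chain M Y x' y' /\ extends id S X Y x y x' y'.
Proof.
move=> [z [zx Mzy]].
have [w Nw] := saturated_solvable z (- (M *m (\I_X *m z))).
pose z' := \I_X *m z + \I_(~: Y :|: S) *m w.
have MwE A : A \subset X :|: S -> \I_A *m (M *m (\I_(~: Y :|: S) *m w)) =
    \I_A *m (\I_X *m (M *m (\I_(~: X) *m z)) - \I_S *m (M *m (\I_X *m z))).
  by move=> sA; rewrite -mulmxN -Nw mulmxA indic_mxSl.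
have dX : [disjoint X & ~: Y :|: S].
  by rewrite disjoints_subset setCU setCK subsetI sXY -disjoints_subset.
have dYXS : [disjoint Y :\: X :\: S & ~: Y :|: S].
  rewrite disjoints_subset setCU setCK; apply/subsetP=> i; rewrite !inE.
  by case/and3P=> -> _ ->.
exists z', (M *m z'); split; first by exists z'.
apply/extends_idP; rewrite /z' !mulmxDr !MwE ?subsetUl ?subsetUr //; split.
- by rewrite !mulmxA (mul_indic_disjoint F dX) indic_mxSl // mul0mx addr0.
- rewrite mulmxBr !(mulmxA \I_X) (indic_mxSl F (subxx X)) (mul_indic_disjoint F dXS).
  by rewrite mul0mx subr0 -!mulmxA -!mulmxDr -mulmxDl indic_mxC mul1mx.
- rewrite mulmxBr !(mulmxA \I_S) (indic_mxSl F (subxx S)).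
  rewrite [\I_S *m \I_X]mul_indic_disjoint 1?disjoint_sym // mul0mx.
  by rewrite sub0r -!mulmxA subrr.
- rewrite !mulmxA (mul_indic_disjoint F dYXS) mul_indic_disjoint ?mul0mx ?addr0 //.
  by apply: disjointWl (subsetDl _ _) _; rewrite disjoints_subset subsetDr.
Qed.

Lemma linked_supported x y x' y' :
    restricted_chain M Y x' y' -> extends id S X Y x y x' y' ->
  supported_chain M X x y <-> supported_chain M Y x' y'.
Proof.
move=> [z [zx' Mzy']] /extends_idP[eqx eqy Sy' Dx'].
have prY : \I_Y = \I_X + \I_S + \I_(Y :\: X :\: S) :> 'M[F]_n.
  rewrite -(indic_mxU F dXS) -indic_mxU; last first.
    by rewrite disjoint_sym setDDl disjoints_subset subsetDr.
  by rewrite setDDl -{1}(setID Y (X :|: S)) (setIidPr _) // subUset sXY.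
have Yx' : \I_Y *m x' = \I_X *m x' + \I_S *m x' by rewrite prY 2!mulmxDl Dx' addr0.
have inY A (u : 'cV[F]_n) : A \subset Y -> \I_A *m (\I_Y *m u) = \I_A *m u.
  by move=> sAY; rewrite mulmxA indic_mxSl.
rewrite /supported_chain -eqx -eqy; split=> supp.
  have Sz : \I_S *m z = \I_S *m x' by rewrite -(inY S z) // zx' inY.
  have outz : \I_(~: Y :|: S) *m z = z - \I_X *m x'.
    apply/eqP; rewrite eq_sym subr_eq (indic_mxU F dYS) mulmxDl Sz -addrA.
    by rewrite [X in _ + X]addrC -Yx' -zx' -mulmxDl addrC indic_mxC mul1mx.
  have [Sz0 cutz0] : \I_S *m z = 0 /\ \I_Y *m (M *m (\I_(~: Y) *m z)) = 0.
    have sXSY : X :|: S \subset Y by rewrite subUset sXY.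
    apply: saturated_kernel; rewrite outz (mulmxBr M) supp mulmxBr -(inY _ _ sXSY).
    rewrite Mzy' inY // mulmxA indic_mxSr ?subsetUl //.
    by rewrite (indic_mxU F dXS) mulmxDl Sy' addr0 subrr.
  rewrite -Mzy' -[z in RHS]mul1mx -(indic_mxC F Y) mulmxDl !mulmxDr cutz0 addr0 zx'.
  by rewrite Yx' -Sz Sz0 addr0 supp mulmxA indic_mxSr.
have [Sx0 cutx0] : \I_S *m x' = 0 /\ \I_(~: X) *m (M *m (\I_X *m x')) = 0.
  apply: saturated_kernel_tr; rewrite (indic_mxU F dXS) (mulmxDl \I_X) -Yx' supp.
  rewrite (indic_mxU F dYS) mulmxDl (inY S) // Sy' addr0 mulmxA.
  rewrite mul_indic_disjoint ?mul0mx //.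
  by rewrite disjoint_sym disjoints_subset setCK.
rewrite Yx' Sx0 addr0 in supp.
by rewrite -[LHS]mul1mx -(indic_mxC F X) mulmxDl cutx0 addr0 supp inY.
Qed.

End SaturatingSet.
End LinkedCuts.

Section LinkedMinor.
Variables (F : finFieldType) (n k : nat) (M : 'M[F]_n) (eps : F) (X Y : {set 'I_n}).
Local Open Scope ring_scope.
Hypotheses (eps0 : eps != 0) (symM : M^T = eps *: M).
Hypotheses (sXY : X \subset Y) (eqXY : cutrank M X = cutrank M Y).
Hypothesis rkY : (cutrank M Y <= k)%N.
Hypothesis linkXY : forall Z : {set 'I_n},
  X \subset Z -> Z \subset Y -> (cutrank M Y <= cutrank M Z)%N.
Local Notation B := ('cV[F]_k * 'cV[F]_k)%type.

Let smallX : small_cut M k X.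
Proof. by rewrite /small_cut (cutrankC X eps0 symM) eqXY rkY. Qed.

Let smallY : small_cut M k Y.
Proof. by rewrite /small_cut (cutrankC Y eps0 symM) rkY. Qed.

Section Twist.
Variable S : {set 'I_n}.
Hypothesis sSYX : S \subset Y :\: X.
Hypothesis saturated : (cutrank M Y + #|S| <= block_rank M (X :|: S) (~: Y :|: S))%N.

Definition boundary_extension (c b : B) : Prop := exists x y x' y',
  [/\ boundary_rel M X x y c, boundary_rel M Y x' y' b & extends id S X Y x y x' y'].

Lemma boundary_extension_eq c1 b1 c2 b2 :
  boundary_extension c1 b1 -> boundary_extension c2 b2 -> c1 = c2 <-> b1 = b2.
Proof.
move=> [x1 [y1 [x1' [y1' [[chain1 <-] [chain1' <-] ext1]]]]].
move=> [x2 [y2 [x2' [y2' [[chain2 <-] [chain2' <-] ext2]]]]].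
rewrite !boundary_eqP //.
apply: (linked_supported eps0 symM sXY eqXY sSYX saturated) => //.
  exact: restricted_chain_sub.
exact: extends_sub.
Qed.

Lemma exists_boundary_extension x y c : boundary_rel M X x y c ->
  exists b x' y', [/\ boundary_extension c b, boundary_rel M Y x' y' b &
    extends id S X Y x y x' y'].
Proof.
move=> Rc; have [chain _] := Rc.
have [x' [y' [chain' ext]]] := linked_extension eps0 symM sXY eqXY sSYX saturated chain.
have Rb : boundary_rel M Y x' y' (boundary M k Y x' y') by [].
by exists (boundary M k Y x' y'), x', y'; split=> //; exists x, y, x', y'.
Qed.

Lemma extending_rel_minor : exists s : {perm B},
  rel_minor (boundary_rel M X) (boundary_rel M Y) X Y s.
Proof.
pose attained := [set c : B | `[< exists b, boundary_extension c b >]].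
have ex_b (c : B) : exists b, c \in attained -> boundary_extension c b.
  have [|nc] := boolP (c \in attained); last by exists 0.
  by rewrite inE => /asboolP[b cb]; exists b.
have [f fP] := choice ex_b.
have [|s sf] := @exists_perm_extending _ attained f.
  move=> c d /fP cf /fP df eq_f; apply/(boundary_extension_eq cf df); exact: eq_f.
have sP c : boundary_extension c (s c) \/ forall b, ~ boundary_extension c b.
  have [c_att|c_natt] := boolP (c \in attained).
    by left; rewrite sf //; exact: fP.
  by right=> b cb; case/negP: c_natt; rewrite inE; apply/asboolP; exists b.
exists s, id, S; rewrite imset_id; split=> // x y c; split=> [Rc|[x' [y' [R'sc ext]]]].
  have [b [x' [y' [cb R'b ext]]]] := exists_boundary_extension Rc.
  exists x', y'; split=> //; have [csc|/(_ b)//] := sP c.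
  by rewrite ((boundary_extension_eq csc cb).1 erefl).
have chain : restricted_chain M X x y.
  have [z [zx' Mzy']] := restricted_chainS sXY R'sc.1.
  by have [eqx eqy _ _] := (extends_idP sSYX _ _ _ _).1 ext; exists z; rewrite zx' Mzy'.
have Rd : boundary_rel M X x y (boundary M k X x y) by [].
have dsc : boundary_extension (boundary M k X x y) (s c) by exists x, y, x', y'.
have [dsd|/(_ (s c))//] := sP (boundary M k X x y).
have /perm_inj <- // := (boundary_extension_eq dsd dsc).1 erefl.
Qed.

End Twist.

Theorem linked_rel_minor : exists s : {perm B},
  rel_minor (boundary_rel M X) (boundary_rel M Y) X Y s.
Proof.
have [S sSYX saturated] := exists_saturating_set sXY linkXY.
exact: extending_rel_minor saturated.
Qed.

End LinkedMinor.

Lemma asbool_set_inj (T : finType) (P Q : T -> Prop) :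
  [set t | `[< P t >]] = [set t | `[< Q t >]] -> forall t, P t <-> Q t.
Proof.
move=> /setP eqPQ t; have := eqPQ t; rewrite !inE => eq_t.
by split=> [/asboolP|/asboolP]; [rewrite eq_t|rewrite -eq_t] => /asboolP.
Qed.

(** * Well-quasi-ordering of decomposed matrices *)

Section BoundariedMatrices.
Variables (F : finFieldType) (k : nat) (eps : F).
Local Open Scope ring_scope.
Hypothesis eps0 : eps != 0.
Local Notation B := ('cV[F]_k * 'cV[F]_k)%type.

Record dmatrix : Type := DMatrix {
  dm_dim : nat;
  dm_mx : 'M[F]_dm_dim;
  dm_tree : dtree 'I_dm_dim
}.

Implicit Types (d e : dmatrix) (P G : dmatrix -> Prop).

Definition dm_vertices e : {set 'I_(dm_dim e)} := vertices (dm_tree e).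
Definition dm_rel e : 'cV[F]_(dm_dim e) -> 'cV[F]_(dm_dim e) -> B -> Prop :=
  boundary_rel (dm_mx e) (dm_vertices e).
Definition dm_label e : nat := cutrank (dm_mx e) (dm_vertices e).

(* A minor is given by a total function between indices, hence the first condition. *)
Definition well_decomposed e : Prop :=
  [/\ (0 < dm_dim e)%N, (dm_mx e)^T = eps *: dm_mx e, separated (dm_tree e),
      width_le (cutrank (dm_mx e)) k (dm_tree e) &
      linked (cutrank (dm_mx e)) (dm_tree e)].

Definition minor_via (phi : B -> B) e e' : Prop :=
  rel_minor (@dm_rel e) (@dm_rel e') (dm_vertices e) (dm_vertices e') phi.
Definition minor e e' : Prop := minor_via id e e'.
Definition twisted_minor e e' : Prop := exists s : {perm B}, minor_via s e e'.

Lemma minor_via_perm_mul (s t : {perm B}) e e' e'' :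
  minor_via s e e' -> minor_via t e' e'' -> minor_via (s * t)%g e e''.
Proof.
move=> le_s le_t; have -> : (s * t)%g = t \o s :> (B -> B).
  by apply/funext=> c; rewrite permM.
exact: rel_minor_trans le_t.
Qed.

Lemma perm1_id : (1%g : {perm B}) = id :> (B -> B).
Proof. by apply/funext=> c; rewrite perm1. Qed.

Lemma minor_trans e e' e'' : minor e e' -> minor e' e'' -> minor e e''.
Proof. exact: rel_minor_trans. Qed.

Lemma twisted_minor_trans e e' e'' :
  twisted_minor e e' -> twisted_minor e' e'' -> twisted_minor e e''.
Proof.
by move=> [s le_s] [t le_t]; exists (s * t)%g; exact: minor_via_perm_mul le_t.
Qed.

Lemma minor_twisted e e' : minor e e' -> twisted_minor e e'.
Proof. by exists 1%g; rewrite perm1_id. Qed.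

Lemma wqo_minor_of_twisted P : wqo P twisted_minor -> wqo P minor.
Proof. by move/(wqo_untwist minor_via_perm_mul); rewrite perm1_id. Qed.

Lemma well_decomposed_small_cut e : well_decomposed e ->
  small_cut (dm_mx e) k (dm_vertices e).
Proof.
case=> _ symM _; rewrite width_leE => /andP[rk _] _.
by rewrite /small_cut (cutrankC _ eps0 symM) rk.
Qed.

Definition single_leaf e : bool := if dm_tree e is Leaf _ then true else false.

Lemma rel_minor_subset1 n n' (M : 'M[F]_n) (M' : 'M[F]_n') v v' (X : {set 'I_n})
    (X' : {set 'I_n'}) : X \subset [set v] -> X' \subset [set v'] ->
    (v \in X) = (v' \in X') ->
    (forall a b (c : B), boundary_rel M X (const_mx a) (const_mx b) c <->
      boundary_rel M' X' (const_mx a) (const_mx b) c) ->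
  rel_minor (B := B) (boundary_rel M X) (boundary_rel M' X') X X' id.
Proof.
move=> sX sX' eqvX eqR.
have Xv i : i \in X -> i = v by move=> /(subsetP sX)/set1P.
have X'v' i : i \in X' -> i = v' by move=> /(subsetP sX')/set1P.
exists (fun=> v'), set0; split=> [i j /Xv -> /Xv -> //||x y c].
  by apply/subsetP=> _ /imsetP[i iX ->]; rewrite -eqvX -(Xv i iX).
have -> : boundary_rel M X x y c <->
    boundary_rel M X (const_mx (x v 0)) (const_mx (y v 0)) c.
  by split; apply: boundary_rel_supported => i /Xv ->; rewrite !mxE.
rewrite eqR; split=> [R'c|[x' [y' [R'c [eqs _]]]]].
  exists (const_mx (x v 0)), (const_mx (y v 0)); split=> //; split=> [i /Xv ->|i].
    by rewrite !mxE.
  case/setDP=> iX' /imsetP[]; exists v; last exact: X'v'.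
  by rewrite eqvX -(X'v' i iX').
apply: boundary_rel_supported R'c => i iX'; rewrite !mxE (X'v' i iX').
by apply: eqs; rewrite eqvX -(X'v' i iX').
Qed.

Definition leaf_trace e : bool * {set F * F * B} := (dm_vertices e == set0,
  [set t | `[< @dm_rel e (const_mx t.1.1) (const_mx t.1.2) t.2 >]]).

Lemma subset_set1_of_card n (X : {set 'I_n}) : (0 < n)%N -> (#|X| <= 1)%N ->
  exists2 v, X \subset [set v] & (v \in X) = (X != set0).
Proof.
move=> n0 X1; have [->|[v vX]] := set_0Vmem X.
  by exists (Ordinal n0); rewrite ?sub0set // inE eqxx.
have -> : X = [set v] by apply/esym/eqP; rewrite eqEcard sub1set vX cards1.
by exists v; rewrite // set11; apply/esym/set0Pn; exists v; exact: set11.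
Qed.

Lemma wqo_leaves : wqo (fun e => well_decomposed e /\ single_leaf e) minor.
Proof.
apply: (wqo_weaken (wqo_finite_color leaf_trace _)).
move=> [n M [X|l r]] [n' M' [X'|l' r']] [[/= n0 _ X1 _ _] //= _];
  move=> [[/= n'0 _ X'1 _ _] //= _].
rewrite /leaf_trace /dm_rel /dm_vertices /= => -[eq0 eq_trace].
have [v sXv vX] := subset_set1_of_card n0 X1.
have [v' sX'v' v'X'] := subset_set1_of_card n'0 X'1.
apply: (rel_minor_subset1 sXv sX'v') => [|a b c]; first by rewrite vX v'X' eq0.
exact: (asbool_set_inj eq_trace (a, b, c)).
Qed.

Definition dm_left e : dmatrix :=
  DMatrix (dm_mx e) (if dm_tree e is Node l _ then l else dm_tree e).
Definition dm_right e : dmatrix :=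
  DMatrix (dm_mx e) (if dm_tree e is Node _ r then r else dm_tree e).

Lemma well_decomposed_left n (M : 'M[F]_n) l r :
  well_decomposed (DMatrix M (Node l r)) -> well_decomposed (DMatrix M l).
Proof.
case=> /= n0 symM /and3P[_ sepl _]; rewrite width_leE => /and3P[_ wl _] [_ [linkl _]].
by split.
Qed.

Lemma well_decomposed_right n (M : 'M[F]_n) l r :
  well_decomposed (DMatrix M (Node l r)) -> well_decomposed (DMatrix M r).
Proof.
case=> /= n0 symM /and3P[_ _ sepr]; rewrite width_leE => /and3P[_ _ wr] [_ [_ linkr]].
by split.
Qed.

Lemma well_decomposed_label e : well_decomposed e -> (dm_label e <= k)%N.
Proof. by case=> _ _ _; rewrite width_leE => /andP[]. Qed.

Definition glue_trace e : {set B * B * B} :=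
  [set t | `[< glue_rel (dm_mx e) (dm_vertices (dm_left e)) (dm_vertices (dm_right e))
    t.1.1 t.1.2 t.2 >]].

Lemma minor_Node n n' (M : 'M[F]_n) (M' : 'M[F]_n') l r l' r' :
    well_decomposed (DMatrix M (Node l r)) ->
    well_decomposed (DMatrix M' (Node l' r')) ->
    glue_trace (DMatrix M (Node l r)) = glue_trace (DMatrix M' (Node l' r')) ->
    minor (DMatrix M l) (DMatrix M' l') -> minor (DMatrix M r) (DMatrix M' r') ->
  minor (DMatrix M (Node l r)) (DMatrix M' (Node l' r')).
Proof.
rewrite /glue_trace /dm_vertices /= => wd wd' eq_trace minl minr.
have glueE (c c1 c2 : B) : glue_rel M (vertices l) (vertices r) c c1 c2 <->
    glue_rel M' (vertices l') (vertices r') c c1 c2.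
  exact: (asbool_set_inj eq_trace (c, c1, c2)).
have gluedE m (N : 'M[F]_m) tl tr : well_decomposed (DMatrix N (Node tl tr)) ->
    forall x y (c : B), boundary_rel N (vertices tl :|: vertices tr) x y c <->
    glued (glue_rel N (vertices tl) (vertices tr))
      (boundary_rel N (vertices tl)) (boundary_rel N (vertices tr)) x y c.
  move=> wdN x y c; have [_ _ /and3P[dN _ _] _ _] := wdN.
  apply: boundary_rel_glued => //; last exact: well_decomposed_small_cut wdN.
    exact: well_decomposed_small_cut (well_decomposed_left wdN).
  exact: well_decomposed_small_cut (well_decomposed_right wdN).
have gluedE' x y (c : B) : boundary_rel M' (vertices l' :|: vertices r') x y c <->
    glued (glue_rel M (vertices l) (vertices r))
      (boundary_rel M' (vertices l')) (boundary_rel M' (vertices r')) x y c.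
  rewrite gluedE //.
  by split=> -[c1 [c2 [R1 R2 Gc]]]; exists c1, c2; split=> //; apply/glueE.
have [_ _ /and3P[dlr _ _] _ _] := wd; have [_ _ /and3P[dlr' _ _] _ _] := wd'.
apply: (eq_rel_minor (gluedE _ _ _ _ wd) gluedE').
by apply: (rel_minor_glue _ dlr dlr' _ _ minl minr); exact: boundary_rel_supported.
Qed.

Lemma wqo_nodes P : wqo P minor ->
  wqo (fun e => [/\ well_decomposed e, ~~ single_leaf e, P (dm_left e) &
    P (dm_right e)]) minor.
Proof.
move=> wqoP; pose le_left e e' := minor (dm_left e) (dm_left e').
pose le_right e e' := minor (dm_right e) (dm_right e').
set Q := fun e => _.
have wqo_l : wqo Q le_left.
  by move=> f Qf; apply: (wqoP (dm_left \o f)) => i; case: (Qf i).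
have wqo_r : wqo Q le_right.
  by move=> f Qf; apply: (wqoP (dm_right \o f)) => i; case: (Qf i).
have trans_lr e1 e2 e3 :
    le_left e1 e2 /\ le_right e1 e2 -> le_left e2 e3 /\ le_right e2 e3 ->
    le_left e1 e3 /\ le_right e1 e3.
  by move=> [l12 r12] [l23 r23]; split; [exact: minor_trans l23|exact: minor_trans r23].
have trans_l e1 e2 e3 : le_left e1 e2 -> le_left e2 e3 -> le_left e1 e3.
  exact: minor_trans.
have wqo_lr := wqo_and trans_l wqo_l wqo_r.
apply: wqo_weaken (wqo_and trans_lr wqo_lr (wqo_finite_color glue_trace _)) _.
move=> [n M [A|l r]] [n' M' [A'|l' r']]; try by [case|move=> _ []].
move=> [wd _ _ _] [wd' _ _ _] [[minl minr] eq_trace]; exact: minor_Node.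
Qed.

Inductive built s G : dmatrix -> Prop :=
  | built_base e : G e -> built s G e
  | built_Node n (M : 'M[F]_n) l r : well_decomposed (DMatrix M (Node l r)) ->
      (s <= dm_label (DMatrix M (Node l r)))%N ->
      built s G (DMatrix M l) -> built s G (DMatrix M r) ->
      built s G (DMatrix M (Node l r)).

Definition below s d e : Prop := exists T b p,
  e = DMatrix (dm_mx d) T /\ path_to (cutrank (dm_mx d)) s (b :: p) T (dm_tree d).

Definition dm_size e : nat := tree_size (dm_tree e).

Lemma below_size s d e : below s d e -> (dm_size d < dm_size e)%N.
Proof.
case=> T [b [p [-> /path_to_size le_size]]]; apply: leq_trans le_size.
by rewrite addnS ltnS leq_addr.
Qed.

Lemma below_left s n (M : 'M[F]_n) l r e : below s (DMatrix M (Node l r)) e ->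
  (s <= dm_label (DMatrix M l))%N -> below s (DMatrix M l) e.
Proof.
case=> T [b [p [-> path]]] sl; exists T, b, (rcons p false); split=> //.
exact: (path_to_rcons (p := b :: p) (b := false) path).
Qed.

Lemma below_right s n (M : 'M[F]_n) l r e : below s (DMatrix M (Node l r)) e ->
  (s <= dm_label (DMatrix M r))%N -> below s (DMatrix M r) e.
Proof.
case=> T [b [p [-> path]]] sr; exists T, b, (rcons p true); split=> //.
exact: (path_to_rcons (p := b :: p) (b := true) path).
Qed.

Lemma below_child s n (M : 'M[F]_n) l r : (s <= dm_label (DMatrix M (Node l r)))%N ->
  ((s <= dm_label (DMatrix M l))%N -> below s (DMatrix M l) (DMatrix M (Node l r))) /\
  ((s <= dm_label (DMatrix M r))%N -> below s (DMatrix M r) (DMatrix M (Node l r))).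
Proof.
by move=> sT; split=> sc; exists (Node l r); [exists false, [::]|exists true, [::]].
Qed.

Lemma below_twisted_minor s d e :
  well_decomposed e -> dm_label e = s -> dm_label d = s ->
  below s d e -> twisted_minor d e.
Proof.
move=> + + + [T [b [p [eq_e path]]]]; rewrite {e}eq_e => wd labT labd.
have rkT := well_decomposed_label wd; case: wd => /= _ symM _ _.
case: T path labT rkT => [//|l r] path labT rkT [root _].
apply: (linked_rel_minor eps0 symM (path_to_sub path)) => [||Z sdZ sZT] //.
  by rewrite [LHS]labd -labT.
by apply: root sdZ sZT; rewrite -labT in path; exact: path.
Qed.

Definition built_at s G e : Prop :=
  [/\ built s G e, well_decomposed e & dm_label e = s].

Lemma built_succ s G (Q : dmatrix -> Prop) d :
    (forall n (M : 'M[F]_n) l r, Q (DMatrix M (Node l r)) ->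
      ((s <= dm_label (DMatrix M l))%N -> Q (DMatrix M l)) /\
      ((s <= dm_label (DMatrix M r))%N -> Q (DMatrix M r))) ->
    built s G d -> ((s <= dm_label d)%N -> Q d) ->
  built s.+1 (fun e => G e \/ built_at s G e /\ Q e) d.
Proof.
move=> Q_child; elim=> {d} [d Gd _|n M l r wd le_s bl IHl br IHr Qd].
  by apply: built_base; left.
have {}Qd := Qd le_s; have [Ql Qr] := Q_child _ _ _ _ Qd.
have [eq_s|ne_s] := eqVneq (dm_label (DMatrix M (Node l r))) s.
  by apply: built_base; right; split=> //; split=> //; exact: built_Node.
by apply: built_Node; [|rewrite ltn_neqAle eq_sym ne_s|exact: IHl|exact: IHr].
Qed.

Lemma wqo_built_at s G : (forall e, G e -> well_decomposed e) -> wqo G minor ->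
    (forall G', (forall e, G' e -> well_decomposed e) -> wqo G' minor ->
       wqo (built s.+1 G') minor) ->
  wqo (built_at s G) twisted_minor.
Proof.
move=> wdG wqoG wqo_succ.
apply: (wqo_nash_williams (sub := below s) (size := dm_size)) => [||f level_f wqo_sub].
- exact: twisted_minor_trans.
- move=> d e [_ _ labd] [_ wde labe] dle.
  by split; [exact: (below_twisted_minor wde) dle|exact: below_size dle].
pose A e := built_at s G e /\ exists i, below s e (f i).
have wqoGA : wqo (fun e => G e \/ A e) minor.
  by apply: wqo_or wqoG _; exact: wqo_minor_of_twisted.
have wqo_succA : wqo (built s.+1 (fun e => G e \/ A e)) minor.
  by apply: wqo_succ => // e [/wdG //|[[_ wde _] _]].
have succA d : built s G d -> ((s <= dm_label d)%N -> exists i, below s d (f i)) ->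
    built s.+1 (fun e => G e \/ A e) d.
  apply: built_succ => n M l r [i bel].
  by split=> sc; exists i; [exact: below_left bel sc|exact: below_right bel sc].
have wqo_f : wqo (fun e => G e \/ [/\ well_decomposed e, ~~ single_leaf e,
    built s.+1 (fun e => G e \/ A e) (dm_left e) &
    built s.+1 (fun e => G e \/ A e) (dm_right e)]) minor by exact/wqo_or/wqo_nodes.
have [i|i [j [ij minor_ij]]] := wqo_f f; last first.
  by exists i, j; split=> //; exact: minor_twisted.
have [bf wf _] := level_f i.
have below_f d : below s d (f i) -> exists i, below s d (f i).
  by exists i.
case: bf wf below_f => [e Ge _ _|n M l r wd le_s bl br _ below_f]; first by left.
have [bel ber] := below_child le_s.
by right; split=> //; apply: succA => // sc; apply: below_f; [exact: bel|exact: ber].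
Qed.

Lemma wqo_built s G : (forall e, G e -> well_decomposed e) -> wqo G minor ->
  wqo (built s G) minor.
Proof.
move Em : (k.+1 - s)%N => m; elim: m s Em G => [|m IH] s Em G wdG wqoG.
  apply: wqo_sub wqoG => e [//|n M l r wd le_s _ _].
  by have := well_decomposed_label wd; move: Em le_s; clear; lia.
have wqo_succ G' : (forall e, G' e -> well_decomposed e) -> wqo G' minor ->
    wqo (built s.+1 G') minor.
  by apply: IH; move: Em; clear; lia.
have wqo_level := wqo_minor_of_twisted (wqo_built_at wdG wqoG wqo_succ).
have wqo_GA : wqo (built s.+1 (fun e => G e \/ built_at s G e /\ True)) minor.
  apply: wqo_succ => [e [/wdG //|[[_ wde _] _] //]|].
  by apply: wqo_or wqoG _; apply: wqo_sub wqo_level => e [].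
by apply: wqo_sub wqo_GA => e; move/built_succ; apply.
Qed.

Theorem wqo_well_decomposed : wqo well_decomposed minor.
Proof.
have leaf_wd e : well_decomposed e /\ single_leaf e -> well_decomposed e by case.
apply: wqo_sub (wqo_built (s := 0%N) leaf_wd wqo_leaves).
case=> n M T; elim: T => [A|l IHl r IHr] wde; first exact: built_base.
apply: built_Node => //; first exact/IHl/well_decomposed_left/wde.
exact/IHr/well_decomposed_right/wde.
Qed.

End BoundariedMatrices.

(** * Schur complements *)

Section SchurMinor.
Variable F : fieldType.
Local Open Scope ring_scope.

Definition schur_minor m n (A : 'M[F]_m) (M : 'M[F]_n) : Prop :=
  exists Y : {set 'I_n}, principal_submatrix M Y \in unitmx /\
    exists Z : {set 'I_#|~: Y|},
      matrix_isomorphic A (principal_submatrix (schur_complement M Y) Z).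

Lemma isomorphic_principal_submatrix m n (A : 'M[F]_m) (M : 'M[F]_n) (C : {set 'I_n})
    (f : 'I_m -> 'I_n) :
    injective f -> (forall i, f i \in C) -> (forall i j, A i j = M (f i) (f j)) ->
  exists Z : {set 'I_#|C|},
    matrix_isomorphic A (principal_submatrix (submatrix M C C) Z).
Proof.
move=> inj_f fC eqA; pose rank_f i := enum_rank_in (fC i) (f i).
have rank_fK i : enum_val (rank_f i) = f i by rewrite enum_rankK_in.
have rank_f_inj : injective rank_f.
  by move=> i j eq_ij; apply: inj_f; rewrite -!rank_fK eq_ij.
pose Z := rank_f @: setT; have rank_fZ i : rank_f i \in Z by exact: imset_f.
exists Z, (fun i => enum_rank_in (rank_fZ i) (rank_f i)); split; last first.
  by move=> i j; rewrite !mxE !enum_rankK_in // !rank_fK eqA.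
apply: inj_card_bij => [i j /(congr1 enum_val)|].
  by rewrite !enum_rankK_in //; exact: rank_f_inj.
by rewrite !card_ord card_imset // cardsT card_ord.
Qed.

Section PivotBlock.
Variables (n : nat) (M : 'M[F]_n) (B : {set 'I_n}).

Definition block_inv : 'M[F]_n :=
  (row_selector F B)^T *m invmx (principal_submatrix M B) *m row_selector F B.

Definition schur_mx : 'M[F]_n := M - M *m block_inv *m M.

Lemma schur_complementE : schur_complement M B = submatrix schur_mx (~: B) (~: B).
Proof.
by rewrite /schur_complement !submatrixE /schur_mx /block_inv mulmxBr mulmxBl !mulmxA.
Qed.

Lemma mul_indic_block_inv : \I_B *m block_inv = block_inv.
Proof.
rewrite /block_inv -mul_tr_row_selector !mulmxA -(mulmxA _ _ _^T).
by rewrite mul_row_selector_tr mulmx1.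
Qed.

Hypothesis unitB : principal_submatrix M B \in unitmx.

Lemma mul_block_inv : \I_B *m M *m block_inv = \I_B.
Proof.
rewrite -mul_tr_row_selector; set R := row_selector F B.
have -> : R^T *m R *m M *m block_inv =
    R^T *m (R *m M *m R^T *m invmx (principal_submatrix M B)) *m R by rewrite !mulmxA.
by rewrite -submatrixE mulmxV // mulmx1.
Qed.

Lemma schur_minor_of_entries m (A : 'M[F]_m) (f : 'I_m -> 'I_n) :
    injective f -> (forall i, f i \notin B) ->
    (forall i j, A i j = schur_mx (f i) (f j)) ->
  schur_minor A M.
Proof.
move=> inj_f fB eqA; exists B; split=> //; rewrite schur_complementE.
by apply: isomorphic_principal_submatrix inj_f _ eqA => i; rewrite inE.
Qed.

Section Vanishing.
Variable S : {set 'I_n}.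
Hypothesis sBS : B \subset S.
Hypothesis spanB : (\I_S *m M *m \I_S <= \I_B *m M *m \I_S)%MS.

Lemma schur_mx_vanish (x e : 'cV[F]_n) :
  \I_(~: S) *m x = \I_(~: S) *m e -> \I_S *m (M *m x) = 0 ->
  \I_S *m (schur_mx *m e) = 0.
Proof.
move=> eqx Mx0; pose z := e - block_inv *m (M *m e).
have -> : schur_mx *m e = M *m z by rewrite mulmxBr mulmxBl !mulmxA.
have Bz0 : \I_B *m (M *m z) = 0.
  by rewrite /z !mulmxBr (mulmxA M) !(mulmxA \I_B) mul_block_inv -mulmxA subrr.
have Bx0 : \I_B *m (M *m x) = 0 by rewrite -(indic_mxSl F sBS) -mulmxA Mx0 mulmx0.
have supp : \I_S *m (z - x) = z - x.
  have : \I_(~: S) *m (z - x) = 0.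
    rewrite !mulmxBr eqx -mul_indic_block_inv -!mulmxA (mulmxA \I_(~: S)).
    rewrite mul_indic_disjoint; last by rewrite disjoint_sym disjoints_subset setCK.
    by rewrite mul0mx subr0 subrr.
  by move=> C0; rewrite -[RHS]mul1mx -(indic_mxC F S) mulmxDl C0 addr0.
have -> : \I_S *m (M *m z) = \I_S *m M *m \I_S *m (z - x).
  by rewrite -!mulmxA supp !mulmxBr Mx0 subr0.
have [K ->] := submxP spanB.
by rewrite -!mulmxA supp (mulmxBr M) (mulmxBr \I_B) Bz0 Bx0 subrr mulmx0.
Qed.

End Vanishing.
End PivotBlock.

Lemma exists_pivot_block n (M : 'M[F]_n) (eps : F) (S : {set 'I_n}) :
    eps != 0 -> M^T = eps *: M ->
  exists B : {set 'I_n}, [/\ B \subset S, principal_submatrix M B \in unitmx &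
    (\I_S *m M *m \I_S <= \I_B *m M *m \I_S)%MS].
Proof.
move=> eps0 symM.
have [N defN] : exists N, N = \I_S *m M *m \I_S by exists (\I_S *m M *m \I_S).
have symN : N^T = eps *: N by rewrite defN; exact: tr_mul_indic_mx.
have N0 i j : i \notin S -> N i j = 0.
  by rewrite defN -mulmxA mul_indic_mxE => /negbTE->.
pose f := maxrankfun N; pose B := [set f i | i in 'I_(\rank N)] :&: S.
have sBS : B \subset S by exact: subsetIr.
have BN : \I_B *m N = \I_B *m M *m \I_S by rewrite defN !mulmxA indic_mxSl.
have spanB : (N <= \I_B *m N)%MS.
  rewrite -(eq_maxrowsub N); apply/row_subP=> i; rewrite row_rowsub.
  suff -> : row (f i) N = row (f i) (\I_B *m N) by exact: row_sub.
  apply/rowP=> j; rewrite mxE [RHS]mxE mul_indic_mxE inE imset_f //=.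
  by case: ifPn => // /N0.
exists B; split=> //; last by rewrite -BN -defN.
have [K eqK] := submxP spanB.
have eqKT : N = N *m \I_B *m K^T.
  apply: (scalerI eps0); rewrite -symN {1}eqK !trmx_mul tr_indic_mx symN.
  by rewrite -!scalemxAl.
have rankN : (\rank N <= \rank (\I_B *m M *m \I_B))%N.
  have -> : \I_B *m M *m \I_B = \I_B *m N *m \I_B by rewrite BN -!mulmxA indic_mxSr.
  have {1}-> : N = K *m (\I_B *m N *m \I_B) *m K^T.
    by rewrite !mulmxA -(mulmxA K) -eqK -eqKT.
  exact: leq_trans (mxrankM_maxl _ _) (mxrankM_maxr _ _).
rewrite -row_free_unit /row_free rank_submatrix eqn_leq.
rewrite -{1}(rank_submatrix M B B) rank_leq_row (leq_trans _ rankN) //.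
rewrite -[X in (_ <= X)%N]card_ord; apply: leq_trans (leq_imset_card f _).
exact/subset_leq_card/subsetIl.
Qed.

Lemma schur_minor_of_extends n n' (M : 'M[F]_n) (M' : 'M[F]_n') (eps : F)
    (f : 'I_n -> 'I_n') (S : {set 'I_n'}) :
    eps != 0 -> M'^T = eps *: M' -> injective f ->
    (forall x y, y = M *m x <->
       exists x' y', y' = M' *m x' /\ extends f S setT setT x y x' y') ->
  schur_minor M M'.
Proof.
move=> eps0 symM' inj_f relM; pose S0 := S :\: f @: setT.
have [B [sBS unitB spanB]] := exists_pivot_block S0 eps0 symM'.
have fS0 i : f i \notin S0 by rewrite inE imset_f.
have fB i : f i \notin B by apply: contra (fS0 i); exact: subsetP.
apply: (schur_minor_of_entries unitB inj_f fB) => i j.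
pose e : 'cV[F]_n' := delta_mx (f j) 0; pose z := e - block_inv M' B *m (M' *m e).
have Mz : M' *m z = schur_mx M' B *m e by rewrite mulmxBr mulmxBl !mulmxA.
have eE w : e w 0 = (w == f j)%:R by rewrite mxE andbT.
have zE w : w \notin B -> z w 0 = e w 0.
  move=> nwB; rewrite mxE [X in _ + X]mxE -mul_indic_block_inv -mulmxA mul_indic_mxE.
  by rewrite (negbTE nwB) subr0.
have off_f w : w \in setT :\: f @: setT -> e w 0 = 0.
  by case/setDP=> _ nfw; rewrite eE; case: eqP nfw => // ->; rewrite imset_f.
have Sz0 : \I_S0 *m (M' *m z) = 0.
  have [x [_ [-> [eqs zeros]]]] := (relM (delta_mx j 0) _).1 erefl.
  rewrite Mz; apply: (schur_mx_vanish unitB sBS spanB (x := x)).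
    apply/eq_mul_indic_mx=> w; rewrite !inE negb_and negbK.
    have [/imsetP[i' _ ->] _|nfw /= nwS] := boolP (w \in f @: setT).
      by have [-> _] := eqs i' (in_setT _); rewrite eE mxE andbT (inj_eq inj_f).
    have w_off : w \in setT :\: f @: setT by rewrite inE nfw in_setT.
    by have := zeros w w_off; rewrite (negbTE nwS) off_f.
  apply/mul_indic_mx_eq0=> w /setDP[wS nfw].
  by have := zeros w; rewrite inE nfw in_setT wS => /(_ isT).
have /matrixP/(_ i 0) : \col_w (M' *m z) (f w) 0 = M *m delta_mx j 0 :> 'cV_n.
  apply/relM; exists z, (M' *m z); split=> //; split=> [i' _|w w_off].
    by rewrite zE // eE !mxE andbT (inj_eq inj_f).
  have [_ nfw] := setDP w_off; case: ifPn => [wS|nwS].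
    by apply: (mul_indic_mx_eq0 S0 _).1 Sz0 _ _; rewrite inE nfw.
  by rewrite zE ?off_f //; apply: contra nwS => /(subsetP sBS)/setDP[].
by rewrite Mz -!colE !mxE.
Qed.

Theorem schur_minor_of_rel_minor n n' k (M : 'M[F]_n) (M' : 'M[F]_n') (eps : F) :
    eps != 0 -> M'^T = eps *: M' ->
    rel_minor (B := 'cV[F]_k * 'cV[F]_k) (boundary_rel M setT) (boundary_rel M' setT)
      setT setT id ->
  schur_minor M M'.
Proof.
move=> eps0 symM' [f [S [inj_f _ rel]]].
apply: (schur_minor_of_extends (f := f) (S := S) eps0 symM') => [i j|x y].
  by apply: inj_f; rewrite in_setT.
have setTE m (N : 'M[F]_m) u v : v = N *m u <-> boundary_rel (k := k) N setT u v (0, 0).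
  by rewrite boundary_rel_setT; split=> [->|[]].
rewrite setTE rel; split=> -[x' [y' [Rc ext]]]; exists x', y'; split=> //; exact/setTE.
Qed.

Lemma schur_minor0 m n (A : 'M[F]_m) (M : 'M[F]_n) : m = 0%N -> schur_minor A M.
Proof.
move=> m0; have no_idx (i : 'I_m) : False by case: i => i; rewrite m0.
have unit0 : principal_submatrix M set0 \in unitmx.
  by rewrite -row_free_unit /row_free eqn_leq rank_leq_row [X in (X <= _)%N]cards0.
apply: (schur_minor_of_entries unit0 (f := fun i => False_rect _ (no_idx i))) => i;
  by case: (no_idx i).
Qed.

End SchurMinor.

(** * Trees from rank-decompositions *)

Section TreeBranches.
Variables (V : finType) (e : rel V).
Hypothesis e_tree : is_tree e.
Implicit Types (u v w x : V) (p : seq V).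

Let e_sym : symmetric e. Proof. by case: e_tree. Qed.
Let e_irr : irreflexive e. Proof. by case: e_tree. Qed.

Definition branch u v : {set V} := [set x | connect (delete_edge e u v) u x].

Lemma delete_edgeC u v : delete_edge e u v =2 delete_edge e v u.
Proof. by move=> x y; rewrite /delete_edge; congr andb; exact: andbC. Qed.

Lemma delete_edge_sym u v : symmetric (delete_edge e u v).
Proof.
move=> x y; rewrite /delete_edge e_sym; congr andb.
by rewrite andbC !xpair_eqE; congr (~~ _ && ~~ _); exact: andbC.
Qed.

Lemma path_delete_edge u v w p :
  u \notin w :: p -> path e w p -> path (delete_edge e u v) w p.
Proof.
elim: p w => //= x p IH w; rewrite !inE !negb_or => /and3P[uw ux up] /andP[wx px].
rewrite IH ?inE ?negb_or ?ux // andbT /delete_edge wx !xpair_eqE.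
by rewrite [w == u]eq_sym (negbTE uw) [x == u]eq_sym (negbTE ux) andbF.
Qed.

Lemma branch_refl u v : u \in branch u v. Proof. by rewrite inE connect0. Qed.

Lemma notin_branch u v : e u v -> v \notin branch u v.
Proof.
move=> uv; rewrite inE; apply/negP=> /connectP[p0 path0 last0].
case/shortenP: path0 last0 => p pathp uniqp _ lastp.
have [_ _ _ _ acyclic] := e_tree.
have : ucycle e (u :: p).
  rewrite /ucycle uniqp andbT /= rcons_path -lastp e_sym uv andbT.
  by apply: sub_path pathp => x y /and3P[].
move/acyclic; case: p lastp uniqp pathp => [|w [|w' p]] //=.
  by move=> vu; rewrite vu e_irr in uv.
by move=> -> _; rewrite /delete_edge eqxx andbF.
Qed.

Lemma branchP u v x : e u v ->
  reflect (exists p, [/\ path e u p, last u p = x, uniq (u :: p) & v \notin u :: p])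
    (x \in branch u v).
Proof.
move=> uv; rewrite inE.
apply: (iffP idP) => [/connectP[p0 path0 ->]|[p [pathp <- _ vp]]].
  case/shortenP: path0 => p pathp uniqp _; exists p; split=> //.
    by apply: sub_path pathp => y z /and3P[].
  apply: contra (notin_branch uv); rewrite in_cons => /predU1P[->|vp].
    exact: branch_refl.
  case/splitPr: vp pathp => p1 p2; rewrite cat_path /= inE => /and3P[path1 last1 _].
  by apply/connectP; exists (rcons p1 v); rewrite ?last_rcons // rcons_path path1.
apply/connectP; exists p => //; rewrite (eq_path (delete_edgeC u v)).
exact: path_delete_edge.
Qed.

Lemma branchC u v : e u v -> branch v u = ~: branch u v.
Proof.
move=> uv; apply/setP=> x; rewrite [RHS]inE; apply/idP/idP => [vx|].
  apply: contra (notin_branch uv); rewrite !inE in vx * => ux.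
  apply: connect_trans ux _; rewrite (sym_connect_sym (delete_edge_sym u v)).
  by rewrite (eq_connect (delete_edgeC u v)).
have [_ _ _ conn _] := e_tree; rewrite !inE.
case/connectP: (conn u x) => p0 path0 ->; case/shortenP: path0 => p pathp uniqp _.
case: p pathp uniqp => [|w p] /=; first by rewrite connect0.
case/andP=> uw pathp /andP[up uniqp].
have [wv _|wv] := eqVneq w v.
  apply/connectP; exists p; last by rewrite wv.
  by rewrite (eq_path (delete_edgeC v u)) -wv; exact: path_delete_edge.
case/connectP; exists (w :: p) => //=.
rewrite path_delete_edge // andbT /delete_edge uw !xpair_eqE eqxx (negbTE wv) /=.
by apply: contra up => /andP[_ /eqP <-]; rewrite mem_head.
Qed.

Lemma branch_disjoint v w w' : e v w -> e v w' -> w != w' ->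
  [disjoint branch w v & branch w' v].
Proof.
move=> vw vw' ww'; apply/pred0P=> x /=; apply/negP=> /andP[wx].
have w'v : e w' v by rewrite e_sym.
case/(branchP _ w'v) => p [pathp lastp _ vp].
have : x \in branch v w.
  rewrite inE; apply/connectP; exists (w' :: p) => //=.
  rewrite path_delete_edge // andbT /delete_edge vw' !xpair_eqE eqxx /= eq_sym ww' /=.
  by apply: contra ww' => /andP[/eqP eq_vw _]; rewrite eq_vw e_irr in vw.
by apply/negP; rewrite -in_setC -branchC.
Qed.

Lemma branch_children u v : e u v ->
  branch v u = v |: \bigcup_(w in [set w | e v w] :\ u) branch w v.
Proof.
move=> uv; have vu : e v u by rewrite e_sym.
apply/setP=> x; rewrite in_setU1; apply/idP/predU1P => [|[->|/bigcupP[w]]].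
- case/(branchP _ vu) => -[|w p] /= [pathp <- uniqp up]; first by left.
  case/andP: pathp uniqp => vw pathp /andP[vp uniqp]; right; apply/bigcupP; exists w.
    by move: up; rewrite !inE !negb_or vw andbT [w == u]eq_sym => /and3P[].
  by apply/(branchP _ _); [rewrite e_sym|exists p].
- exact: branch_refl.
case/setD1P=> wu; rewrite in_set => vw xw; rewrite (branchC uv) in_setC.
by rewrite (disjointFr (branch_disjoint vw vu wu) xw).
Qed.

Lemma branch_proper u v w : e u v -> w \in [set w | e v w] :\ u ->
  branch w v \proper branch v u.
Proof.
move=> uv w_child; rewrite (branch_children uv); apply/properP; split.
  by apply: subset_trans (subsetUr _ _); exact: (bigcup_sup w w_child).
exists v; first exact: setU11.
by apply: notin_branch; move: w_child; rewrite !inE e_sym => /andP[].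
Qed.

End TreeBranches.

Section TreeOn.
Variables (V : finType) (lam : {set V} -> nat) (k : nat).
Implicit Types X Y : {set V}.

Definition tree_on X : Prop :=
  exists T : dtree V, [/\ vertices T = X, separated T & width_le lam k T].

Lemma tree_on_small X : #|X| <= 1 -> lam X <= k -> tree_on X.
Proof. by move=> X1 lamX; exists (Leaf X); rewrite width_leE /= lamX. Qed.

Lemma tree_onU X Y : [disjoint X & Y] -> lam (X :|: Y) <= k ->
  tree_on X -> tree_on Y -> tree_on (X :|: Y).
Proof.
move=> dXY lamXY [TX [eqX sepX wX]] [TY [eqY sepY wY]]; exists (Node TX TY).
by rewrite /= eqX eqY dXY sepX width_leE /= eqX eqY lamXY wX.
Qed.

End TreeOn.

Section TreeOfRankDecomposition.
Variables (F : fieldType) (n k : nat) (A : 'M[F]_n) (D : rank_decomposition n).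
Hypothesis Dk : decomposition_width A D <= k.
Local Notation e := (@rd_adj n D).
Local Notation V := (rd_vertex D).
Local Notation tree_on := (tree_on (cutrank A) k).

Let e_tree : is_tree e. Proof. by case: (rd_subcubic D). Qed.

Let e_sym : symmetric e. Proof. by case: e_tree. Qed.

Definition leaf_vertex (i : 'I_n) : V := val (rd_leaf D i).

Lemma leaf_vertex_inj : injective leaf_vertex.
Proof. exact: inj_comp val_inj (bij_inj (rd_leaf_bij D)). Qed.

Lemma edge_sideE u v : edge_side u v = leaf_vertex @^-1: branch e u v.
Proof. by apply/setP=> i; rewrite !inE. Qed.

Lemma edge_sideC u v : e u v -> edge_side v u = ~: edge_side u v.
Proof. by move=> uv; rewrite !edge_sideE (branchC e_tree uv) preimsetC. Qed.

Lemma cutrank_edge_side u v : e u v -> cutrank A (edge_side u v) <= k.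
Proof.
move=> uv; rewrite /cutrank /block_rank -edge_sideC // -rank_submatrix.
apply: leq_trans Dk; rewrite /decomposition_width.
exact: (@leq_bigmax_cond _ (fun p : V * V => e p.1 p.2)
  (fun p : V * V => edge_width A p.1 p.2) (u, v) uv).
Qed.

Lemma edge_side_children u v : e u v -> edge_side v u =
  leaf_vertex @^-1: [set v] :|: \bigcup_(w in [set w | e v w] :\ u) edge_side w v.
Proof.
move=> uv; rewrite edge_sideE (branch_children e_tree uv) preimsetU; congr setU.
rewrite (big_morph _ (preimsetU _) (preimset0 _)).
by apply: eq_bigr => w _; rewrite edge_sideE.
Qed.

Lemma tree_on_edge_side u v : e u v -> tree_on (edge_side v u).
Proof.
have [m] := ubnP #|branch e v u|; elim: m u v => // m IH u v ltm uv.
have vu : e v u by rewrite e_sym.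
have := cutrank_edge_side vu; rewrite edge_side_children //.
set children := _ :\ u => rk_vu.
have child w : w \in children -> tree_on (edge_side w v).
  move=> w_child; apply: IH; last by move: w_child; rewrite !inE => /andP[].
  by apply: leq_trans (proper_card (branch_proper e_tree uv w_child)) _; rewrite -ltnS.
have card_children : degree e v = #|children|.+1.
  by rewrite /degree (cardsD1 u) inE vu.
have [/eqP|nleaf] := boolP (is_leaf e v).
  rewrite card_children => -[/cards0_eq no_child].
  rewrite no_child big_set0 setU0 in rk_vu *.
  apply: tree_on_small => //; apply/card_le1_eqP=> i j.
  by rewrite !inE => /eqP <- /eqP/esym/leaf_vertex_inj.
have no_leaf : leaf_vertex @^-1: [set v] = set0.
  apply/setP=> i; rewrite !inE; apply: contraNF nleaf => /eqP <-; exact: valP.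
have := (rd_subcubic D).2 v.
rewrite no_leaf set0U card_children ltnS in rk_vu * => card_le2.
have /orP[/cards1P[w eq_w]|/cards2P[w [w' [ww' eq_ww']]]] :
    (#|children| == 1) || (#|children| == 2).
  by move: nleaf card_le2; rewrite /is_leaf card_children; case: #|_| => [|[|[]]].
- by rewrite eq_w big_set1; apply: child; rewrite eq_w set11.
have [w_child w'_child] : w \in children /\ w' \in children.
  by rewrite eq_ww' set21 set22.
have eq_cup : \bigcup_(x in children) edge_side x v = edge_side w v :|: edge_side w' v.
  by rewrite eq_ww' big_setU1 ?inE // big_set1.
rewrite eq_cup in rk_vu *; apply: tree_onU rk_vu (child _ w_child) (child _ w'_child).
have [vw vw'] : e v w /\ e v w'.
  by move: w_child w'_child; rewrite !inE => /andP[_ ->] /andP[_ ->].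
rewrite !edge_sideE -setI_eq0 -preimsetI; have := branch_disjoint e_tree vw vw' ww'.
by rewrite -setI_eq0 => /eqP ->; rewrite preimset0.
Qed.

End TreeOfRankDecomposition.

Lemma tree_on_setT (F : fieldType) n k (A : 'M[F]_n) : rank_width A <= k ->
  tree_on (cutrank A) k setT.
Proof.
rewrite /rank_width; case: ex_minnP => w + _.
rewrite /rank_width_candidate; case: leqP => [n1 _ _|n2 /asboolP[D <-] Dk].
  by apply: tree_on_small; rewrite ?cutrankT // cardsT card_ord.
have [e_tree _] := rd_subcubic D; have [_ e_sym _ _ _] := e_tree.
pose u := leaf_vertex D (Ordinal (ltnW n2)).
have /cards1P[v eq_v] : is_leaf (@rd_adj n D) u by exact: valP.
have uv : rd_adj u v by have := set11 v; rewrite -eq_v inE.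
have vu : rd_adj v u by rewrite e_sym.
rewrite -(setUCr (edge_side u v)) -(edge_sideC uv); apply: tree_onU.
- by rewrite (edge_sideC uv) disjoints_subset setCK.
- by rewrite (edge_sideC uv) setUCr cutrankT.
- exact: tree_on_edge_side.
- exact: tree_on_edge_side.
Qed.

Section Sequences.
Variables (F : finFieldType) (k : nat) (eps : F).
Local Open Scope ring_scope.
Hypothesis eps0 : eps != 0.

Lemma exists_well_decomposed n (M : 'M[F]_n) :
    (0 < n)%N -> M^T = eps *: M -> (rank_width M <= k)%N ->
  exists T, well_decomposed k eps (DMatrix M T) /\ vertices T = setT.
Proof.
move=> n0 symM /tree_on_setT[T0 [eqT0 sepT0 widthT0]].
have [T [eqT sepT widthT] linkedT] := exists_linked_rearrangement
  (fun X => cutrankC X eps0 symM) (@cutrank_submod _ _ M) (cutrank0 M) sepT0 widthT0.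
by exists T; rewrite eqT.
Qed.

Lemma eps_symmetric_schur_minor (n : nat -> nat) (M : forall i, 'M[F]_(n i)) :
    (forall i, (0 < n i)%N) -> (forall i, (M i)^T = eps *: M i) ->
    (forall i, (rank_width (M i) <= k)%N) ->
  exists i j, (i < j)%N /\ schur_minor (M i) (M j).
Proof.
move=> n0 symM rwM.
have T i := cid (exists_well_decomposed (n0 i) (symM i) (rwM i)).
have [|i [j [ij]]] :=
    @wqo_well_decomposed F k eps eps0 (fun i => DMatrix (M i) (sval (T i))).
  by move=> i; case: (svalP (T i)).
rewrite /minor /minor_via /dm_rel /dm_vertices /= (svalP (T i)).2 (svalP (T j)).2.
move=> minor_ij.
by exists i, j; split=> //; exact: schur_minor_of_rel_minor (symM j) minor_ij.
Qed.

End Sequences.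

Theorem theorem7p1 (F : finFieldType) (k : nat) (n : nat -> nat)
    (M : forall i : nat, 'M[F]_(n i)) :
  (forall i, skew_symmetric_matrix (M i) \/ symmetric_matrix (M i)) ->
  (forall i, rank_width (M i) <= k) ->
  exists i j : nat, i < j /\
    exists Y : {set 'I_(n j)},
      principal_submatrix (M j) Y \in unitmx /\
      exists Z : {set 'I_#|~: Y|},
        matrix_isomorphic (M i)
          (principal_submatrix (schur_complement (M j) Y) Z).
Proof.
move=> symM rwM.
have [[i n0]|pos] := pselect (exists i, n i = 0).
  by exists i, i.+1; split=> //; exact: schur_minor0.
have n_gt0 i : 0 < n i by rewrite lt0n; apply/eqP=> ni0; apply: pos; exists i.
have subseq (g : nat -> nat) (eps : F) : {homo g : i j / i < j} -> (eps != 0)%R ->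
    (forall i, (M (g i))^T = eps *: M (g i))%R ->
    exists i j, i < j /\ schur_minor (M i) (M j).
  move=> g_incr eps0 symMg.
  have [i [j [ij minor_ij]]] := @eps_symmetric_schur_minor F k eps eps0 _
    (fun i => M (g i)) (fun i => n_gt0 _) symMg (fun i => rwM _).
  by exists (g i), (g j); split; first exact: g_incr.
have [inf_sym|/existsNP[N no_sym]] :=
    pselect (infinitely_often (fun i => symmetric_matrix (M i))).
  have [g g_incr symMg] := infinitely_often_subseq inf_sym.
  by apply: (subseq g 1%R g_incr) => [|i]; rewrite ?oner_eq0 // scale1r -symMg.
apply: (subseq (addn N) (-1)%R) => [i j||i]; first by rewrite ltn_add2l.
  by rewrite oppr_eq0 oner_eq0.
case: (symM (N + i)) => [[skewM _]|sym]; first by rewrite scaleN1r [in RHS]skewM opprK.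
by case: no_sym; exists (N + i); rewrite ?leq_addr.
Qed.
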